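(* The problem $\{1,2\}$-CSP$(\mathbf{P}_\infty)$ is decidable in polynomial time.
   Context: $\mathbf{P}_\infty$ is the infinite path: vertex set $\mathbb{Z}$, edges $\{i,k\}$ with $|i-k|=1$. $\{1,2\}$-CSP$(\mathbf{P}_\infty)$ takes as input a sentence $Q_1 x_1 \ldots Q_m x_m\, \psi$, where $\psi$ is a conjunction of atoms $E(x_i,x_k)$ and each $Q_i$ is $\exists^{\geq 1}$ (i.e. $\exists$) or $\exists^{\geq 2}$ (there exist at least two distinct elements), and asks whether it is true in $\mathbf{P}_\infty$. *)

(* Defs.v *)
From HB Require Import structures.
From Stdlib Require Import PosDef.
From mathcomp Require Import all_boot all_order all_algebra.

Set Implicit Arguments.
Unset Strict Implicit.
Unset Printing Implicit Defensive.

Import Order.TTheory GRing.Theory Num.Theory.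

Inductive direction := MoveL | Stay | MoveR.

Section Tape.
Variable G : Type.

(* The cell under the head, the cells to its left and the cells to its right, *)
(* both listed from the head outwards; all the cells beyond them are blank.   *)
(* [None] is the blank symbol.                                                *)
Record tape := Tape {
  tape_left : seq (option G);
  tape_cur : option G;
  tape_right : seq (option G) }.

Definition tape_write (a : option G) (t : tape) : tape :=
  Tape (tape_left t) a (tape_right t).

Definition tape_move (d : direction) (t : tape) : tape :=
  let: Tape l a r := t in
  match d with
  | MoveL => Tape (behead l) (head None l) (a :: r)
  | Stay => t
  | MoveR => Tape (a :: l) (head None r) (behead r)
  end.

Definition blank_tape : tape := Tape [::] None [::].

Definition tape_of_seq (s : seq G) : tape :=
  Tape [::] (ohead s) (map Some (behead s)).

End Tape.

(* Deterministic multi-tape Turing machines over the input alphabet [A]. The   *)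
(* tape symbols are the letters of [A], finitely many work symbols            *)
(* and the blank. There is at least one tape, and tape [ord0] initially       *)
(* carries the input, with the head on its first letter. The machine halts as *)
(* soon as it enters a state [q] with [tm_verdict q = Some b]; it then        *)
(* accepts if [b] is true and rejects otherwise.                              *)
Record TM (A : finType) := MkTM {
  tm_aux : nat;
  tm_work : finType;
  tm_state : finType;
  tm_start : tm_state;
  tm_verdict : tm_state -> option bool;
  tm_delta : tm_state -> {ffun 'I_tm_aux.+1 -> option (A + tm_work)} ->
             tm_state * ('I_tm_aux.+1 -> option (A + tm_work) * direction) }.

Section Run.
Variables (A : finType) (M : TM A).

Record config := Config {
  cfg_state : tm_state M;
  cfg_tapes : 'I_(tm_aux M).+1 -> tape (A + tm_work M) }.

Definition init_config (w : seq A) : config :=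
  Config (tm_start M)
    (fun i => if i == ord0 then tape_of_seq (map inl w) else blank_tape _).

Definition step (c : config) : config :=
  if tm_verdict (cfg_state c) is Some _ then c else
  let: (q, act) :=
    tm_delta (cfg_state c) [ffun i => tape_cur (cfg_tapes c i)] in
  Config q (fun i =>
    tape_move (act i).2 (tape_write (act i).1 (cfg_tapes c i))).

Definition run (t : nat) (w : seq A) : config := iter t step (init_config w).

(* [step] is the identity on halted configurations, so it is enough to look   *)
(* at the configuration reached after exactly [t] steps.                      *)
Definition halts_within (t : nat) (w : seq A) (b : bool) : Prop :=
  tm_verdict (cfg_state (run t w)) = Some b.

End Run.

(* The machine must halt within the bound on every word over [A].             *)
Definition polytime_language (A : finType) (L : seq A -> Prop) : Prop :=
  exists (M : TM A) (p : {poly nat}), forall w : seq A,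
    exists2 b : bool, halts_within M p.[size w]%R w b & (b <-> L w).

(* A decision problem on objects of type [T] is identified with the language  *)
(* of the encodings of its yes-instances; words that encode no object are     *)
(* thus to be rejected.                                                       *)
Definition polytime_decidable (A : finType) (T : Type) (enc : T -> seq A)
    (yes : T -> Prop) : Prop :=
  polytime_language (fun w => exists2 x : T, enc x = w & yes x).

Inductive quantifier := ExistsGe1 | ExistsGe2.

Definition threshold (q : quantifier) : nat :=
  match q with ExistsGe1 => 1 | ExistsGe2 => 2 end.

(* The sentence Q_0 x_0 ... Q_(m-1) x_(m-1) psi, where Q_i is the i-th item   *)
(* of [qprefix] and psi is the conjunction of the atoms E(x_i, x_k) for       *)
(* (i, k) in [atoms].                                                         *)
Record sentence := Sentence {
  nvars : nat;
  qprefix : nvars.-tuple quantifier;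
  atoms : seq ('I_nvars * 'I_nvars) }.

Section Semantics.
Variables (T : Type) (E : T -> T -> Prop).

Definition exists_at_least (j : nat) (P : T -> Prop) : Prop :=
  exists2 f : 'I_j -> T, injective f & forall i, P (f i).

(* [quantify qs vs P]: under the values [vs] of the variables quantified so   *)
(* far (in order), the remaining prefix [qs] followed by [P] holds.           *)
Fixpoint quantify (qs : seq quantifier) (vs : seq T) (P : seq T -> Prop) :
    Prop :=
  if qs is q :: qs' then
    exists_at_least (threshold q) (fun a => quantify qs' (rcons vs a) P)
  else P vs.

(* [onth vs i] is always [Some _] here, as [vs] has one value per variable.   *)
Definition holds (phi : sentence) : Prop :=
  quantify (qprefix phi) [::] (fun vs =>
    forall i k, (i, k) \in atoms phi ->
      exists a b, [/\ onth vs i = Some a, onth vs k = Some b & E a b]).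

End Semantics.

Definition Pinf_edge (i k : int) : Prop := `|i - k|%R = 1%R.

Inductive token := TokEx1 | TokEx2 | TokE | TokComma | TokBit of bool.

Definition token_code (t : token) : 'I_6 :=
  match t with
  | TokEx1 => inord 0 | TokEx2 => inord 1 | TokE => inord 2
  | TokComma => inord 3 | TokBit b => inord (4 + b)
  end.

Definition token_decode (i : 'I_6) : token :=
  nth TokEx1 [:: TokEx1; TokEx2; TokE; TokComma; TokBit false; TokBit true] i.

Lemma token_codeK : cancel token_code token_decode.
Proof. by case=> [||||[]]; rewrite /token_decode /token_code inordK. Qed.

HB.instance Definition _ := Finite.copy token (can_type token_codeK).

(* Binary numerals, least significant bit first; 0 is the empty numeral.      *)
Fixpoint pos_bits (p : positive) : seq bool :=
  match p with
  | xH => [:: true]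
  | xO p' => false :: pos_bits p'
  | xI p' => true :: pos_bits p'
  end.

Definition nat_bits (n : nat) : seq bool :=
  if bin_of_nat n is Npos p then pos_bits p else [::].

Definition encode_quantifier (q : quantifier) : token :=
  match q with ExistsGe1 => TokEx1 | ExistsGe2 => TokEx2 end.

Definition encode_var (i : nat) : seq token := map TokBit (nat_bits i).

Definition encode_atom (m : nat) (e : 'I_m * 'I_m) : seq token :=
  TokE :: encode_var e.1 ++ TokComma :: encode_var e.2.

Definition encode (phi : sentence) : seq token :=
  map encode_quantifier (qprefix phi)
    ++ flatten (map (@encode_atom (nvars phi)) (atoms phi)).

Lemma nat_bits_inj : injective nat_bits.
Proof.
have pos_bits_inj p q : pos_bits p = pos_bits q -> p = q.
  elim: p q => [p IHp|p IHp|] [q|q|] //=; try by case=> /IHp ->.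
  - by case: p {IHp}.
  - by case: q.
have pos_bits0 p : pos_bits p <> [::] by case: p.
move=> m n mn; apply: (can_inj bin_of_natK); move: mn; rewrite /nat_bits.
case: (bin_of_nat m) (bin_of_nat n) => [|p] [|q] //.
- by move/esym/pos_bits0.
- by move/pos_bits0.
- by move/pos_bits_inj->.
Qed.

Lemma encode_inj : injective encode.
Proof.
pose nobit s := if s is TokBit _ :: _ then false else true.
have catbits b b' s s' : nobit s -> nobit s' ->
    map TokBit b ++ s = map TokBit b' ++ s' -> b = b' /\ s = s'.
  move=> ns ns'; elim: b b' => [|x b IH] [|x' b'] /=.
  - by [].
  - by move=> es; rewrite es in ns.
  - by move=> es; rewrite -es in ns'.
  - by case=> -> /IH[-> ->].
have atoms_nobit m (s : seq ('I_m * 'I_m)) :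
    nobit (flatten (map (@encode_atom m) s)) by case: s.
have atoms_inj m : injective (fun s => flatten (map (@encode_atom m) s)).
  elim=> [|[i k] s IH] [|[i' k'] s'] //= [].
  rewrite -!catA !cat_cons => /catbits[] // /nat_bits_inj/val_inj <- [].
  by move/catbits=> [] // /nat_bits_inj/val_inj <- /IH <-.
have prefix_inj m m' (a : seq ('I_m * 'I_m)) (a' : seq ('I_m' * 'I_m')) q q' :
    map encode_quantifier q ++ flatten (map (@encode_atom m) a)
      = map encode_quantifier q' ++ flatten (map (@encode_atom m') a') ->
    q = q' /\ flatten (map (@encode_atom m) a)
                = flatten (map (@encode_atom m') a').
  elim: q q' => [|x q IH] [|x' q'] //=.
  - by case: a x' => [|? ?] [].
  - by clear IH; case: a' x => [|? ?] [].
  - by case=> exx /IH[-> ->]; case: x x' exx => [] [].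
move=> [m [q sq] a] [m' [q' sq'] a'] /prefix_inj /= [eq ea].
case: _ / eq in sq' *; have em := eqP sq; rewrite (eqP sq') in em.
case: _ / em in sq a ea *; move/atoms_inj: ea => <-.
by congr Sentence; apply: val_inj.
Qed.

(* Main.v *)
Require Import Defs.
From Stdlib Require Import FunctionalExtensionality PosDef.
From mathcomp Require Import all_boot all_order all_algebra.
From mathcomp Require Import zify ring.

Set Implicit Arguments.
Unset Strict Implicit.
Unset Printing Implicit Defensive.

Import Order.TTheory GRing.Theory Num.Theory.

(* Play the quantifiers as a game in which the values of the variables are
   chosen in order. Eliminating the last variable x from distance constraints
   |x - u| <= k yields the constraints |u - v| <= k1 + k2 - 2 b on the remaining
   variables, with b = 1 if x is quantified by "at least two" and b = 0
   otherwise: on the values of one parity, finitely many intervals have two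
   common points as soon as any two of them do. This gives a relation D(v, u, k)
   for u <= v, and the sentence holds iff the constraint graph is bipartite and
   no "at least two" variable is constrained to equal an earlier one. The first i
   values can be kept within distance i of each other, so only the bounds k below
   the length N of the input matter.

   D, its parity analogue W (odd closed walks), and the relations needed to read
   the input are defined on positions of the input word by first-order formulas
   that refer to the relation being defined only at larger first arguments. One
   descending sweep over all triples of positions computes such a relation, and
   a Turing machine can do so in polynomial time: a variable is the position of a
   head on a copy of the input, a ternary relation is a tape of bits. *)

(** * Composable finite-control devices and their Turing machines *)

(** Once a bipartition fixes the parities, the values of x allowed by |x - u| <= k form an interval
    whose two ends have the parity of x. Finitely many such intervals share a point of that parity
    iff the largest lower end is at most the smallest upper end, and share two iff these ends differ
    by at least 2; this is the origin of the term 2 b, and why pairs of constraints suffice. If b =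
    1 and k1 + k2 < 2, the new bound would be negative, which D cannot record; but then k1 or k2 is
    0, so x is constrained to equal an earlier variable, and this is excluded separately. Parities
    are kept in their own relation W so that the bipartition argument does not have to follow the
    sizes of bounds and their cut-off at N. Variables fit into the same frame as bounds because the
    i-th quantifier is the i-th letter of the encoding: variable i is position i of the word. *)

Section Device.
Variables (I S : finType).

(** Absolute head positions and contents indexed by [int] let the effect of a program be stated by
    equations; [rep] below relates them to the list-based tapes of the machine model. *)
Definition mem : Type := (I -> int) * (I -> int -> option S).

Definition view (m : mem) : I -> option S := fun i => m.2 i (m.1 i).

Definition dir_int (d : direction) : int :=
  match d with MoveL => -1 | Stay => 0 | MoveR => 1 end%R.

Definition upd (f : int -> option S) (p : int) (s : option S) : int -> option S :=
  fun j => if j == p then s else f j.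

Definition apply (a : I -> option S * direction) (m : mem) : mem :=
  (fun i => m.1 i + dir_int (a i).2, fun i => upd (m.2 i) (m.1 i) (a i).1)%R.

(** A device exits with a boolean, so that tests and commands are composed by the same operation
    [bind]. *)
Record dev := Dev {
  st : finType;
  start : st;
  tr : st -> (I -> option S) -> (st + bool) * (I -> option S * direction) }.

(** Here [t] is only an upper bound on the number of transitions, which keeps the time analysis to
    inequalities. *)
Fixpoint exits (D : dev) (t : nat) (q : st D) (m : mem) (b : bool) (m' : mem) :
    Prop :=
  if t is t'.+1 then
    let m1 := apply (tr q (view m)).2 m in
    match (tr q (view m)).1 with
    | inl q1 => exits t' q1 m1 b m'
    | inr b1 => b1 = b /\ m1 = m'
    end
  else False.

Definition runs (D : dev) m b m' t := exits t (start D) m b m'.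

Lemma exits_le D t t' (q : st D) m b m' :
  t <= t' -> exits t q m b m' -> exits t' q m b m'.
Proof.
elim: t t' q m => [|t IH] [|t'] q m //= lt.
by case: (tr q (view m)).1 => // q1; apply: IH.
Qed.

Lemma runs_le D m b m' t t' : t <= t' -> runs D m b m' t -> runs D m b m' t'.
Proof. exact: exits_le. Qed.

Definition atom (f : (I -> option S) -> bool)
    (a : (I -> option S) -> I -> option S * direction) : dev :=
  @Dev unit tt (fun _ v => (inr (f v), a v)).

Section Bind.
Variables (D : dev) (K : bool -> dev).

Definition bind_st : finType := (st D + (st (K true) + st (K false)))%type.

Definition bind_enter (b : bool) : bind_st :=
  if b then inr (inl (start (K true))) else inr (inr (start (K false))).

(** The last transition of [D] leads directly into the continuation, so running times simply add
    up. *)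
Definition bind : dev := @Dev bind_st (inl (start D)) (fun q v =>
  match q with
  | inl q => let: (r, a) := tr q v in
      (match r with inl q' => inl (inl q') | inr b => inl (bind_enter b) end, a)
  | inr (inl q) => let: (r, a) := tr q v in
      (match r with inl q' => inl (inr (inl q')) | inr b => inr b end, a)
  | inr (inr q) => let: (r, a) := tr q v in
      (match r with inl q' => inl (inr (inr q')) | inr b => inr b end, a)
  end).

Lemma exits_bindT t (q : st (K true)) m b m' :
  exits t q m b m' -> @exits bind t (inr (inl q)) m b m'.
Proof.
by elim: t q m => //= t IH q m; case: (tr q (view m)) => [[q1|b1] a] //= /IH.
Qed.

Lemma exits_bindF t (q : st (K false)) m b m' :
  exits t q m b m' -> @exits bind t (inr (inr q)) m b m'.
Proof.
by elim: t q m => //= t IH q m; case: (tr q (view m)) => [[q1|b1] a] //= /IH.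
Qed.

Lemma runs_bind m b m1 t1 b' m2 t2 :
  runs D m b m1 t1 -> runs (K b) m1 b' m2 t2 -> runs bind m b' m2 (t1 + t2).
Proof.
rewrite /runs => HD HK.
suff: forall q : st D, exits t1 q m b m1 -> @exits bind (t1 + t2) (inl q) m b' m2.
  by apply.
elim: t1 m {HD} => //= t1 IH m q.
case: (tr q (view m)) => [[q1|b1] a] /=; first exact: IH.
case=> -> ->; apply: (exits_le (leq_addl t1 _)).
by case: b HK {IH} => HK; [apply: exits_bindT|apply: exits_bindF].
Qed.

End Bind.

Definition loop (D : dev) : dev := @Dev (st D) (start D) (fun q v =>
  let: (r, a) := tr q v in
  (match r with
   | inl q' => inl q'
   | inr true => inl (start D)
   | inr false => inr false
   end, a)).

Lemma runs_loop_stop D m m' t :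
  runs D m false m' t -> runs (loop D) m false m' t.
Proof.
rewrite /runs /= => HD.
suff: forall q : st D, exits t q m false m' -> @exits (loop D) t q m false m'.
  by apply.
elim: t m {HD} => //= t IH m q.
by case: (tr q (view m)) => [[q1|b1] a] /=; [apply: IH | case=> -> ->].
Qed.

Lemma runs_loop_step D m m1 t1 b m' t2 :
  runs D m true m1 t1 -> runs (loop D) m1 b m' t2 ->
  runs (loop D) m b m' (t1 + t2).
Proof.
rewrite /runs /= => HD HL.
suff: forall q : st D, exits t1 q m true m1 -> @exits (loop D) (t1 + t2) q m b m'.
  by apply.
elim: t1 m {HD} => //= t1 IH m q.
case: (tr q (view m)) => [[q1|b1] a] /=; first exact: IH.
by case=> -> ->; apply: (exits_le (leq_addl t1 _)).
Qed.

End Device.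

Section Simulation.
Variables (A : finType) (J work : finType).
Notation G := (A + work)%type.
Notation I := (option J).

Definition rep (t : tape G) (p : int) (f : int -> option G) : Prop :=
  [/\ forall i : nat, nth None (tape_left t) i = f (p - 1 - i%:Z)%R,
      tape_cur t = f p
    & forall i : nat, nth None (tape_right t) i = f (p + 1 + i%:Z)%R].

Lemma rep_move t p f a d : rep t p f ->
  rep (tape_move d (tape_write a t)) (p + dir_int d)%R (upd f p a).
Proof.
case: t => l c r [/= Hl Hc Hr].
have updE (z z' : int) : z' = z -> z != p -> upd f p a z' = f z.
  by move=> -> /negbTE zp; rewrite /upd zp.
have upd_p (z : int) : z = p -> upd f p a z = a.
  by move=> ->; rewrite /upd eqxx.
case: d; split=> /=.
- by move=> i; rewrite nth_behead Hl (updE (p - 1 - i.+1%:Z)%R) //; lia.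
- by rewrite -nth0 Hl (updE (p - 1 - 0%:Z)%R) //; lia.
- case=> [|i] /=; first by rewrite upd_p //; lia.
  by rewrite Hr (updE (p + 1 + i%:Z)%R) //; lia.
- by move=> i; rewrite Hl (updE (p - 1 - i%:Z)%R) //; lia.
- by rewrite upd_p //; lia.
- by move=> i; rewrite Hr (updE (p + 1 + i%:Z)%R) //; lia.
- case=> [|i] /=; first by rewrite upd_p //; lia.
  by rewrite Hl (updE (p - 1 - i%:Z)%R) //; lia.
- by rewrite -nth0 Hr (updE (p + 1 + 0%:Z)%R) //; lia.
- by move=> i; rewrite nth_behead Hr (updE (p + 1 + i.+1%:Z)%R) //; lia.
Qed.

(** The index [None] is the input tape [ord0]; the other indices are work tapes named by [J]. *)
Definition tape_ix (i : 'I_#|J|.+1) : I := omap enum_val (unlift ord0 i).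

Definition ix_tape (i : I) : 'I_#|J|.+1 :=
  if i is Some j then lift ord0 (enum_rank j) else ord0.

Lemma ix_tapeK : cancel ix_tape tape_ix.
Proof.
by rewrite /tape_ix => -[j|] /=; rewrite ?unlift_none // liftK /= enum_rankK.
Qed.

Lemma tape_ixK : cancel tape_ix ix_tape.
Proof.
by rewrite /tape_ix => i; case: unliftP => [j|] -> //=; rewrite enum_valK.
Qed.

Variable D : dev I G.

Definition dev_TM : TM A := @MkTM A #|J| work (st D + bool)%type (inl (start D))
  (fun q => if q is inr b then Some b else None)
  (fun q v => if q is inl q' then
       let: (q1, a) := tr q' (fun i => v (ix_tape i)) in (q1, fun i => a (tape_ix i))
     else (q, fun i => (v i, Stay))).

Definition rep_all (T : 'I_#|J|.+1 -> tape G) (m : mem I G) :=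
  forall i, rep (T i) (m.1 (tape_ix i)) (m.2 (tape_ix i)).

Lemma dev_TM_exits t (q : st D) m b m' (T : 'I_#|J|.+1 -> tape G) :
  rep_all T m -> exits t q m b m' ->
  cfg_state (iter t (@step A dev_TM) (@Config A dev_TM (inl q) T)) = inr b.
Proof.
elim: t q m T => //= t IH q m T HT.
rewrite -iterS iterSr {2}/step /=.
have -> : (fun i => [ffun i0 => tape_cur (T i0)] (ix_tape i)) = view m.
  apply: functional_extensionality => i; rewrite ffunE /view.
  by case: (HT (ix_tape i)) => _ -> _; rewrite ix_tapeK.
case: (tr q (view m)) => [[q1|b1] a] /= H.
  by apply: IH H => i /=; apply: rep_move.
(* The device may exit before the bound; a halted configuration is a fixed point of [step], so the
   remaining steps change nothing. *)
case: H => -> _; elim: t {IH} => [|t IH] //=.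
by rewrite {1}/step; case: (iter _ _ _) IH => q2 T2 /= ->.
Qed.

Definition input_mem (w : seq A) : mem I G :=
  (fun=> 0%R, fun i z => if i is Some _ then None else
     if z is Posz n then omap inl (onth w n) else None).

Lemma dev_TM_halts w b m' t :
  runs D (input_mem w) b m' t -> halts_within dev_TM t w b.
Proof.
move=> H; rewrite /halts_within /run /init_config.
rewrite (@dev_TM_exits t (start D) (input_mem w) b m') // => i.
rewrite -(tape_ixK i); case: (tape_ix i) => [j|] /=.
  by rewrite (ix_tapeK (Some j)); split=> [k||k] //=; rewrite nth_default.
rewrite (ix_tapeK None); split=> [k||k] /=.
- by rewrite (_ : 0 - 1 - k%:Z = Negz k)%R ?nth_default //; lia.
- by case: w {H} => [|a w].
- case: w {H} => [|a w] /=; first by rewrite nth_default.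
  by rewrite add0n; elim: w k => [|a' w IH] [|k] //=.
Qed.

End Simulation.

(** * Counting with heads on copies of the input *)

Definition poly_bounded (f : nat -> nat) : Prop :=
  exists p : {poly nat}, forall n, f n <= p.[n]%R.

Lemma poly_bounded_const c : poly_bounded (fun=> c).
Proof. by exists (c%:P)%R => n; rewrite hornerC. Qed.

Lemma poly_bounded_id : poly_bounded id.
Proof. by exists 'X%R => n; rewrite hornerX. Qed.

Lemma poly_bounded_add f g :
  poly_bounded f -> poly_bounded g -> poly_bounded (fun n => f n + g n).
Proof.
by move=> [p Hp] [q Hq]; exists (p + q)%R => n; rewrite hornerD leq_add.
Qed.

Lemma poly_bounded_mul f g :
  poly_bounded f -> poly_bounded g -> poly_bounded (fun n => f n * g n).
Proof.
by move=> [p Hp] [q Hq]; exists (p * q)%R => n; rewrite hornerM leq_mul.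
Qed.

Ltac polyb := repeat first
  [ assumption | exact: poly_bounded_const | exact: poly_bounded_id
  | apply: poly_bounded_add | apply: poly_bounded_mul ].

Section HeadMoves.
Variables (I S : finType).
Implicit Types (p : I -> int) (C : I -> int -> option S).

Definition pset (i : I) (z : int) p : I -> int :=
  fun j => if j == i then z else p j.

Lemma pset_same i z p : pset i z p i = z.
Proof. by rewrite /pset eqxx. Qed.

Lemma pset_other i j z p : j != i -> pset i z p j = p j.
Proof. by rewrite /pset => /negbTE->. Qed.

Lemma pset_id i p : pset i (p i) p = p.
Proof. by apply: functional_extensionality => j; rewrite /pset; case: eqP => [->|]. Qed.

Lemma pset_pset i z z' p : pset i z (pset i z' p) = pset i z p.
Proof. by apply: functional_extensionality => j; rewrite /pset; case: eqP. Qed.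

Definition mv (i : I) (d : direction) : dev I S :=
  atom (fun=> true) (fun v j => (v j, if j == i then d else Stay)).

Definition rd (f : option S -> bool) (i : I) : dev I S :=
  atom (fun v => f (v i)) (fun v j => (v j, Stay)).

Definition ret (b : bool) : dev I S := atom (fun=> b) (fun v j => (v j, Stay)).

Definition wr (i : I) (s : option S) : dev I S :=
  atom (fun=> true) (fun v j => (if j == i then s else v j, Stay)).

Lemma upd_id (f : int -> option S) z : upd f z (f z) = f.
Proof. by apply: functional_extensionality => y; rewrite /upd; case: eqP => [->|]. Qed.

Lemma runs_mv i d p C :
  runs (mv i d) (p, C) true (pset i (p i + dir_int d)%R p, C) 1.
Proof.
split=> //; congr pair; apply: functional_extensionality => j /=.
  by rewrite /pset; case: eqP => [->|_] //=; rewrite addr0.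
by rewrite /view /= upd_id.
Qed.

Lemma runs_stay (f : (I -> option S) -> bool) p C :
  runs (atom f (fun v j => (v j, Stay))) (p, C) (f (view (p, C))) (p, C) 1.
Proof.
split=> //; congr pair; apply: functional_extensionality => j /=.
  by rewrite addr0.
by rewrite /view /= upd_id.
Qed.

Lemma runs_rd f i p C : runs (rd f i) (p, C) (f (C i (p i))) (p, C) 1.
Proof. exact: runs_stay. Qed.

Lemma runs_ret b p C : runs (ret b) (p, C) b (p, C) 1.
Proof. exact: (runs_stay (fun=> b)). Qed.

Lemma runs_wr i s p C : runs (wr i s) (p, C) true
  (p, fun j => if j == i then upd (C i) (p i) s else C j) 1.
Proof.
split=> //; congr pair; apply: functional_extensionality => j /=.
  by rewrite addr0.
by case: eqP => [->|_] //; rewrite /view /= upd_id.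
Qed.

End HeadMoves.

Arguments ret {I S} b.
Arguments mv {I S} i d.
Arguments rd {I S} f i.

Notation "D ;; E" := (bind D (fun=> E)) (at level 51, right associativity).
Notation "'If' D 'Then' E 'Else' F" :=
  (bind D (fun b => if b then E else F)) (at level 50, E at level 50, F at level 50).

Section Counting.
Variables (I A : finType).
Notation G := (A + unit)%type.
Notation dev := (dev I G).
Variable w : seq A.
Notation N := (size w).
Implicit Types (p : I -> int) (C : I -> int -> option G).

(** A head on such a tape serves as a counter: position v stands for the number v, and the blanks at
    -1 and [N] stop the loops at both ends. *)
Definition word_tape (z : int) : option G :=
  if z is Posz n then omap inl (onth w n) else None.

Lemma word_tape_Posz n : word_tape (Posz n) = (n < N) :> bool.
Proof. by rewrite /= -onthTE; case: onth. Qed.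

Lemma word_tape_in (z : int) : (0 <= z < N%:Z)%R -> word_tape z = true :> bool.
Proof. by case: z => [n|n]; last lia; rewrite word_tape_Posz => /andP[_]; lia. Qed.

Lemma word_tape_out (z : int) : ~~ (0 <= z < N%:Z)%R -> word_tape z = false :> bool.
Proof. by case: z => [n|n] //; rewrite word_tape_Posz; lia. Qed.

Definition is_some (s : option G) : bool := s.

Definition while_nonblank (i : I) (D : dev) : dev :=
  loop (If rd is_some i Then D Else ret false).

Lemma while_stop i D p C : C i (p i) = false :> bool ->
  runs (while_nonblank i D) (p, C) false (p, C) 2.
Proof.
move=> Ci; apply: runs_loop_stop.
by apply: (@runs_bind _ _ _ _ _ _ _ 1 _ _ 1 (runs_rd _ _ _ _)); rewrite /is_some Ci; apply: runs_ret.
Qed.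

Lemma while_step i D p C m t b m' t' : C i (p i) = true :> bool ->
  runs D (p, C) true m t -> runs (while_nonblank i D) m b m' t' ->
  runs (while_nonblank i D) (p, C) b m' (t.+1 + t').
Proof.
move=> Ci HD; apply: runs_loop_step.
by apply: (@runs_bind _ _ _ _ _ _ _ 1 _ _ t (runs_rd _ _ _ _)); rewrite /is_some Ci.
Qed.

Definition scan i d := while_nonblank i (mv i d).

Lemma runs_scanL i p C v : C i = word_tape -> v <= N -> p i = (v%:Z - 1)%R ->
  runs (scan i MoveL) (p, C) false (pset i (-1) p, C) (2 * v + 2)%N.
Proof.
move=> Ci; elim: v p => [|v IH] p vN pi.
  rewrite (_ : pset _ _ _ = p); last by rewrite -[in RHS](pset_id i p) pi.
  by apply: while_stop; rewrite Ci pi.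
apply: (@runs_le _ _ _ _ _ _ (2 + (2 * v + 2))); first lia.
apply: while_step; last 1 first.
- rewrite -(pset_pset i (-1) (v%:Z - 1)); apply: (IH (pset i _ p)); first lia.
  by rewrite pset_same.
- by rewrite Ci word_tape_in //; lia.
- rewrite (_ : v%:Z - 1 = p i + dir_int MoveL)%R; last by rewrite pi /=; lia.
  exact: runs_mv.
Qed.

Lemma runs_scanR i p C v : C i = word_tape -> v <= N -> p i = (N%:Z - v%:Z)%R ->
  runs (scan i MoveR) (p, C) false (pset i N p, C) (2 * v + 2)%N.
Proof.
move=> Ci; elim: v p => [|v IH] p vN pi.
  rewrite (_ : pset _ _ _ = p); last by rewrite -[in RHS](pset_id i p) pi subr0.
  by apply: while_stop; rewrite Ci word_tape_out //; lia.
apply: (@runs_le _ _ _ _ _ _ (2 + (2 * v + 2))); first lia.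
apply: while_step; last 1 first.
- rewrite -(pset_pset i N (N%:Z - v%:Z)); apply: (IH (pset i _ p)); first lia.
  by rewrite pset_same.
- by rewrite Ci word_tape_in //; lia.
- rewrite (_ : N%:Z - v%:Z = p i + dir_int MoveR)%R; last by rewrite pi /=; lia.
  exact: runs_mv.
Qed.

Lemma runs_to (D : dev) m b p p' C t :
  p = p' -> runs D m b (p, C) t -> runs D m b (p', C) t.
Proof. by move->. Qed.

(** [As] lists the scratch counters of [D]. They are required to be at 0, and as only [r] changes
    they are back at 0 afterwards, so that [D] can be iterated. *)
Definition shifts (D : dev) (r : I) (d : int) (As : seq I) C (t : nat) : Prop :=
  forall p, {in As, forall a, p a = 0%R} ->
    runs D (p, C) true (pset r (p r + d)%R p, C) t.

Lemma shifts_mv r d As C : shifts (mv r d) r (dir_int d) As C 1.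
Proof. by move=> p _; apply: runs_mv. Qed.

Lemma runs_seq (D E : dev) m b m1 b' m2 t1 t2 :
  runs D m b m1 t1 -> runs E m1 b' m2 t2 -> runs (D ;; E) m b' m2 (t1 + t2).
Proof. exact: (@runs_bind _ _ D (fun=> E)). Qed.

Definition rewind (a : I) : dev := mv a MoveL ;; scan a MoveL ;; mv a MoveR.

Lemma runs_rewind a p C v : C a = word_tape -> v <= N -> p a = Posz v ->
  runs (rewind a) (p, C) true (pset a 0 p, C) (2 * N + 4).
Proof.
move=> Ca vN pa.
apply: (@runs_le _ _ _ _ _ _ (1 + ((2 * v + 2) + 1))); first lia.
apply: runs_seq; first exact: runs_mv.
apply: runs_seq.
  by apply: (runs_scanL Ca vN); rewrite pset_same pa.
rewrite pset_pset -(pset_pset a 0 (-1)).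
rewrite -[X in pset a X (pset _ _ _)](_ : pset a (-1) p a + dir_int MoveR = 0)%R.
  exact: runs_mv.
by rewrite pset_same.
Qed.

(** Multiplies a displacement by [N]; nested, it yields the powers of [N] needed to address cells in
    base [N] without any arithmetic on numerals. *)
Definition repeat_word (a : I) (D : dev) : dev :=
  while_nonblank a (D ;; mv a MoveR) ;; rewind a.

Lemma shifts_repeat a D r d As C t : C a = word_tape -> a \notin As -> r \notin As ->
  a != r -> shifts D r d As C t ->
  shifts (repeat_word a D) r (N%:Z * d)%R (a :: As) C (N * (t + 2) + 2 * N + 6).
Proof.
move=> Ca aAs rAs ar HD p Hp.
apply: (@runs_le _ _ _ _ _ _ ((N * (t + 2) + 2) + (2 * N + 4))); first lia.
have loopP v : v <= N -> forall p, p a = (N%:Z - v%:Z)%R ->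
    {in As, forall b, p b = 0%R} ->
    runs (while_nonblank a (D ;; mv a MoveR)) (p, C) false
      (pset a N (pset r (p r + v%:Z * d) p), C)%R (v * (t + 2) + 2).
  elim: v => [|v IH] vN q qa qAs.
    rewrite mul0r addr0 pset_id (_ : pset _ _ _ = q); last first.
      by rewrite -[in RHS](pset_id a q) qa subr0.
    by apply: while_stop; rewrite Ca word_tape_out //; lia.
  apply: (@runs_le _ _ _ _ _ _ ((t + 1).+1 + (v * (t + 2) + 2))); first lia.
  apply: while_step; first by rewrite Ca word_tape_in //; lia.
    apply: runs_seq; first exact: HD.
    exact: runs_mv.
  rewrite pset_other // qa /=.
  set q' := pset a _ _.
  have -> : pset a N (pset r (q r + v.+1%:Z * d) q)%R
      = pset a N (pset r (q' r + v%:Z * d) q')%R.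
    apply: functional_extensionality => j; rewrite /q' /pset !eqxx [r == a]eq_sym.
    by rewrite (negbTE ar); case: (j == a); case: (j == r) => //=; lia.
  apply: IH; first lia.
    by rewrite /q' pset_same; lia.
  move=> b bAs; rewrite /q' !pset_other ?qAs //.
    by apply: contraNneq rAs => <-.
  by apply: contraNneq aAs => <-.
apply: runs_seq.
  apply: (loopP N) => //; first by rewrite Hp ?mem_head //; lia.
  by move=> b bAs; rewrite Hp // inE bAs orbT.
apply: runs_to; last by apply: (runs_rewind Ca (leqnn _)); rewrite pset_same.
apply: functional_extensionality => j; rewrite /pset.
by case: (j =P a) => [->|//]; rewrite (negbTE ar) Hp ?mem_head.
Qed.

(* Runs D once for each v <= p x, counting on the tape a0; one run more than
   the value of x since the loop ends on the blank left of the origin. *)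
Definition repeat_upto (x a0 : I) (D : dev) : dev :=
  while_nonblank x (mv x MoveL ;; mv a0 MoveR ;; D) ;; mv a0 MoveL ;;
  while_nonblank a0 (mv a0 MoveL ;; mv x MoveR) ;; mv a0 MoveR.

Lemma runs_upto x a0 D r d As C t p v :
  C x = word_tape -> C a0 = word_tape -> x \notin As -> a0 \notin As -> r \notin As ->
  x != r -> a0 != r -> x != a0 -> shifts D r d As C t ->
  v < N -> p x = Posz v -> p a0 = 0%R -> {in As, forall a, p a = 0%R} ->
  runs (repeat_upto x a0 D) (p, C) true (pset r (p r + v.+1%:Z * d)%R p, C)
    (N * (t + 6) + 6).
Proof.
move=> Cx Ca xAs aAs rAs xr ar xa HD vN px pa pAs.
apply: (@runs_le _ _ _ _ _ _ ((v.+1 * (t + 3) + 2) + (1 + ((v.+1 * 3 + 2) + 1)))).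
  have: v.+1 * (t + 6) <= N * (t + 6) by rewrite leq_mul2r vN orbT.
  lia.
(* The value of [x] is counted down to -1 while [a0] records how far it moved. *)
have loop1 u : u <= N -> forall p, p x = (u%:Z - 1)%R ->
    {in As, forall b, p b = 0%R} ->
    runs (while_nonblank x (mv x MoveL ;; mv a0 MoveR ;; D)) (p, C) false
      (pset x (-1) (pset a0 (p a0 + u%:Z) (pset r (p r + u%:Z * d) p)), C)%R
      (u * (t + 3) + 2).
  elim: u => [|u IH] uN q qx qAs.
    rewrite mul0r !addr0 !pset_id (_ : pset _ _ _ = q); last first.
      by rewrite -[in RHS](pset_id x q) qx.
    by apply: while_stop; rewrite Cx qx.
  apply: (@runs_le _ _ _ _ _ _ ((1 + (1 + t)).+1 + (u * (t + 3) + 2))); first lia.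
  apply: while_step; first by rewrite Cx word_tape_in //; lia.
    apply: runs_seq; first exact: runs_mv.
    apply: runs_seq; first exact: runs_mv.
    apply: HD => b bAs; rewrite !pset_other ?qAs //.
      by apply: contraNneq xAs => <-.
    by apply: contraNneq aAs => <-.
  set q' := pset r _ _.
  have -> : (pset x (-1) (pset a0 (q a0 + u.+1%:Z) (pset r (q r + u.+1%:Z * d) q))
     = pset x (-1) (pset a0 (q' a0 + u%:Z) (pset r (q' r + u%:Z * d) q')))%R.
    apply: functional_extensionality => j; rewrite /q' /pset !eqxx.
    rewrite [r == x]eq_sym [r == a0]eq_sym [a0 == x]eq_sym.
    rewrite (negbTE xr) (negbTE ar) (negbTE xa).
    by case: (j == x); case: (j == a0); case: (j == r) => //=; lia.
  apply: IH; first lia.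
    by rewrite /q' !(pset_other _ _ xr, pset_other _ _ xa, pset_same) qx /=; lia.
  move=> b bAs; rewrite /q' !pset_other ?qAs //.
  - by apply: contraNneq xAs => <-.
  - by apply: contraNneq aAs => <-.
  - by apply: contraNneq rAs => <-.
(* The value recorded on [a0] is moved back to [x]. *)
have loop2 u : u <= N -> forall p, p a0 = (u%:Z - 1)%R ->
    runs (while_nonblank a0 (mv a0 MoveL ;; mv x MoveR)) (p, C) false
      (pset a0 (-1) (pset x (p x + u%:Z) p), C)%R (u * 3 + 2).
  elim: u => [|u IH] uN q qa.
    rewrite !addr0 !pset_id (_ : pset _ _ _ = q); last first.
      by rewrite -[in RHS](pset_id a0 q) qa.
    by apply: while_stop; rewrite Ca qa.
  apply: (@runs_le _ _ _ _ _ _ ((1 + 1).+1 + (u * 3 + 2))); first lia.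
  apply: while_step; first by rewrite Ca word_tape_in //; lia.
    apply: runs_seq; exact: runs_mv.
  set q' := pset x _ _.
  have -> : (pset a0 (-1) (pset x (q x + u.+1%:Z) q)
     = pset a0 (-1) (pset x (q' x + u%:Z) q'))%R.
    apply: functional_extensionality => j; rewrite /q' /pset !eqxx (negbTE xa) /=.
    by case: (j == x); case: (j == a0) => //=; lia.
  apply: IH; first lia.
  by rewrite /q' pset_other 1?eq_sym // pset_same qa /=; lia.
apply: runs_seq; first by apply: (loop1 v.+1) => //; lia.
apply: runs_seq; first exact: runs_mv.
apply: runs_seq.
  apply: (loop2 v.+1) => //.
  by rewrite /pset !eqxx [a0 == x]eq_sym (negbTE xa) pa /=; lia.
apply: runs_to; last exact: runs_mv.
apply: functional_extensionality => j; rewrite /pset !eqxx.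
rewrite ?[r == x]eq_sym ?[r == a0]eq_sym ?[a0 == x]eq_sym.
rewrite ?(negbTE xr) ?(negbTE ar) ?(negbTE xa) /=.
case: (j =P x) => [->|_]; first by rewrite (negbTE xa) (negbTE xr) px; lia.
by case: (j =P a0) => [->|//]; rewrite (negbTE ar) pa; lia.
Qed.

End Counting.

Arguments rewind {I A} a.
Arguments scan {I A} i d.

(** * Evaluating formulas and recursive definitions *)

Section Formula.
Variables (A : finType) (V R : nat).

(** Variables are de Bruijn levels: [Ex] appends its variable at the end of the environment. Hence
    each variable keeps the same number, and so the same tape, in its whole scope. *)
Inductive fml :=
  | Letter of (A -> bool) & nat
  | Sum of seq nat & nat & seq nat
  | Rel of nat & nat & nat & nat
  | Neg of fml
  | Conj of fml & fml
  | Ex of fml.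

Definition letter (w : seq A) (f : A -> bool) (i : nat) : bool :=
  if onth w i is Some a then f a else false.

Fixpoint sat (w : seq A) (rho : nat -> nat -> nat -> nat -> bool)
    (env : seq nat) (phi : fml) : bool :=
  match phi with
  | Letter f x => letter w f (nth 0 env x)
  | Sum xs a ys =>
      sumn (map (nth 0 env) xs) + a == sumn (map (nth 0 env) ys)
  | Rel r x y z => rho r (nth 0 env x) (nth 0 env y) (nth 0 env z)
  | Neg phi => ~~ sat w rho env phi
  | Conj phi psi => sat w rho env phi && sat w rho env psi
  | Ex phi => has (fun v => sat w rho (rcons env v) phi) (iota 0 (size w))
  end.

Fixpoint wf (d : nat) (phi : fml) : bool :=
  match phi with
  | Letter _ x => x < d
  | Sum xs _ ys => all (fun x => x < d) xs && all (fun x => x < d) ys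
  | Rel r x y z => [&& r <= R, x < d, y < d & z < d]
  | Neg phi => wf d phi
  | Conj phi psi => wf d phi && wf d psi
  | Ex phi => (d <= V) && wf d.+1 phi
  end.

(** Of the four auxiliary tapes, 0, 1 and 2 are scratch counters. The last one, [ruler], carries a
    single mark at the origin: a head displaced by the difference of two sums sees the mark iff the
    sums are equal. *)
Definition tapes : finType := ('I_V.+1 + 'I_R.+1 + 'I_4)%type.
Notation I := (option tapes).
Notation G := (A + unit)%type.
Notation dev := (dev I G).

Definition vt (x : nat) : I := Some (inl (inl (inord x))).
Definition rt (r : nat) : I := Some (inl (inr (inord r))).
Definition aux (j : nat) : I := Some (inr (inord j)).
Definition ruler : I := aux 3.

Lemma rt_inj r s : r <= R -> s <= R -> (rt r == rt s) = (r == s).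
Proof.
move=> rR sR; apply/eqP/eqP => [[/(congr1 val)]|->] //=.
by rewrite !inordK.
Qed.

Lemma aux_inj i j : i < 4 -> j < 4 -> (aux i == aux j) = (i == j).
Proof.
move=> i4 j4; apply/eqP/eqP => [[/(congr1 val)]|->] //=.
by rewrite !inordK.
Qed.

(** The resting positions of the heads between operations; variables out of scope are at 0, the
    default of [nth]. *)
Definition posof (env : seq nat) (i : I) : int :=
  if i is Some (inl (inl x)) then Posz (nth 0 env x) else 0%R.

Lemma posof_vt env x : x <= V -> posof env (vt x) = Posz (nth 0 env x).
Proof. by move=> xV; rewrite /= inordK. Qed.

Lemma posof_rcons env d v : size env = d -> d <= V ->
  posof (rcons env v) = pset (vt d) (Posz v) (posof env).
Proof.
move=> se dV; apply: functional_extensionality => -[[[x|r]|j]|] //.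
rewrite /pset /= nth_rcons se.
have -> : (Some (inl (inl x)) == vt d) = (val x == d).
  apply/eqP/eqP => [[->]|xd]; first by rewrite /= inordK.
  by congr (Some (inl (inl _))); apply: val_inj; rewrite /= inordK.
case: ltngtP => //= xd; by rewrite nth_default // se ltnW.
Qed.

Variable w : seq A.
Notation N := (size w).
Implicit Types C : I -> int -> option G.

Definition good C : Prop :=
  [/\ forall x, C (vt x) = word_tape w,
      forall j, j < 3 -> C (aux j) = word_tape w
    & forall z, C ruler z = (z == 0%R) :> bool].

(** The base-[N] address of a triple, with successors as digits because [repeat_upto] runs its body
    once more than the value of its counter. *)
Definition addr (x y z : nat) : nat := x.+1 + y.+1 * N + z.+1 * (N * N).

Definition relof C (r x y z : nat) : bool := C (rt r) (Posz (addr x y z)).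

Lemma addr_inj x y z x' y' z' :
  x < N -> y < N -> z < N -> x' < N -> y' < N -> z' < N ->
  addr x y z = addr x' y' z' -> [/\ x = x', y = y' & z = z'].
Proof.
have div2 a b a' b' n : a < n -> a' < n -> a + b * n = a' + b' * n ->
    a = a' /\ b = b'.
  move=> an a'n e; have n0 : 0 < n by apply: leq_ltn_trans an.
  have := congr1 (modn^~ n) e; have := congr1 (divn^~ n) e.
  rewrite /= ![_ + _ * n]addnC !divnMDl // !modnMDl.
  by rewrite !divn_small // !modn_small // !addn0 => -> ->.
move=> xN yN zN x'N y'N z'N; rewrite /addr => e.
(* A digit [x.+1] may equal [N], so the summand 1 is removed before dividing by [N]. *)
have [|xx e1] := @div2 x (y.+1 + z.+1 * N) x' (y'.+1 + z'.+1 * N) N xN x'N.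
  nia.
have [yy zz] := @div2 y z.+1 y' z'.+1 N yN y'N ltac:(lia).
by split=> //; case: zz.
Qed.

Definition goto (r x y z : nat) (d : direction) : dev :=
  let D := mv (rt r) d in
  repeat_upto (vt x) (aux 0) D ;;
  repeat_upto (vt y) (aux 0) (repeat_word (aux 1) D) ;;
  repeat_upto (vt z) (aux 0) (repeat_word (aux 2) (repeat_word (aux 1) D)).

Definition goto_time (n : nat) : nat :=
  let t1 := n * 3 + 2 * n + 6 in
  let t2 := n * (t1 + 2) + 2 * n + 6 in
  (n * 7 + 6) + ((n * (t1 + 6) + 6) + (n * (t2 + 6) + 6)).

Lemma aux_nin (j : nat) (js : seq nat) :
  j < 4 -> all (fun i => i < 4) js -> j \notin js -> aux j \notin map aux js.
Proof.
move=> j4 /allP H; apply: contra => /mapP[i ij /eqP].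
by rewrite aux_inj // => [/eqP->|]; last exact: H.
Qed.

Lemma runs_goto r x y z d env k C : good C -> all (fun v => v < N) env ->
  size env <= V.+1 ->
  x < size env -> y < size env -> z < size env ->
  runs (goto r x y z d) (pset (rt r) k (posof env), C) true
    (pset (rt r) (k + (addr (nth 0 env x) (nth 0 env y) (nth 0 env z))%:Z
                      * dir_int d)%R (posof env), C) (goto_time N).
Proof.
move=> [gv ga _] /allP Henv sV xs ys zs.
have lt i : i < size env -> nth 0 env i < N by move=> ?; apply/Henv/mem_nth.
rewrite /goto; set D := mv (rt r) d.
have S1 As : shifts D (rt r) (dir_int d) As C 1 by apply: shifts_mv.
have S2 As : aux 1 \notin As -> rt r \notin As ->
    shifts (repeat_word (aux 1) D) (rt r) (N%:Z * dir_int d)%R (aux 1 :: As) C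
      (N * 3 + 2 * N + 6).
  by move=> a1 rA; apply: (shifts_repeat (ga 1 isT) a1 rA isT (S1 As)).
have S3 : shifts (repeat_word (aux 2) (repeat_word (aux 1) D)) (rt r)
    (N%:Z * (N%:Z * dir_int d))%R [:: aux 2; aux 1] C
      (N * ((N * 3 + 2 * N + 6) + 2) + 2 * N + 6).
  apply: (shifts_repeat (ga 2 isT)) => //; last exact: S2.
  exact: (@aux_nin 2 [:: 1]).
have step E v0 dd As t k0 v : shifts E (rt r) dd As C t ->
    v0 < size env -> v = nth 0 env v0 -> vt v0 \notin As -> aux 0 \notin As -> rt r \notin As ->
    {in As, forall a, posof env a = 0%R} ->
    runs (repeat_upto (vt v0) (aux 0) E) (pset (rt r) k0 (posof env), C) true
      (pset (rt r) (k0 + v.+1%:Z * dd)%R (posof env), C) (N * (t + 6) + 6).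
  move=> HE v0s -> vA aA rA H0.
  apply: runs_to; last first.
    apply: (@runs_upto _ _ _ (vt v0) (aux 0) E (rt r) dd As C t _ (nth 0 env v0));
      rewrite ?gv ?ga ?lt ?posof_vt //.
    - by rewrite /pset /= inordK //; lia.
    - move=> a aAs; rewrite pset_other ?H0 //.
      by apply: contraNneq rA => <-.
  by rewrite pset_same pset_pset.
apply: runs_seq; first by apply: (step D _ _ [::] 1).
apply: runs_seq.
  apply: (step _ _ _ [:: aux 1]); [exact: S2| | | | | |] => //.
    exact: (@aux_nin 0 [:: 1]).
  by move=> a; rewrite inE => /eqP->.
apply: runs_to; last first.
  apply: (step _ _ _ [:: aux 2; aux 1]); [exact: S3| | | | | |] => //.
    exact: (@aux_nin 0 [:: 2; 1]).
  by move=> a; rewrite !inE => /orP[]/eqP->.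
by congr (pset _ _ _); rewrite /addr !PoszD !PoszM; ring.
Qed.

Definition sweep (xs : seq nat) (d : direction) : dev :=
  foldr (fun x K => repeat_upto (vt x) (aux 0) (mv ruler d) ;; K) (ret true) xs.

Lemma runs_sweep xs d env k C : good C -> all (fun v => v < N) env ->
  size env <= V.+1 -> all (fun x => x < size env) xs ->
  runs (sweep xs d) (pset ruler k (posof env), C) true
    (pset ruler (k + (size xs + sumn (map (nth 0 env) xs))%:Z
                      * dir_int d)%R (posof env), C) (size xs * (N * 7 + 6) + 1).
Proof.
move=> [gv ga _] /allP Henv sV; elim: xs k => [|x xs IH] k /=.
  by move=> _; rewrite mul0r addr0; apply: runs_ret.
case/andP=> xs1 /IH{}IH.
apply: (@runs_le _ _ _ _ _ _ ((N * 7 + 6) + (size xs * (N * 7 + 6) + 1))).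
  by rewrite mulSn addnA.
apply: runs_seq.
  apply: (@runs_upto _ _ _ (vt x) (aux 0) _ ruler (dir_int d) [::] C 1 _
          (nth 0 env x)); rewrite ?gv ?ga //.
  - by rewrite aux_inj.
  - exact: shifts_mv.
  - by apply/Henv/mem_nth.
  - by rewrite pset_other // posof_vt //; lia.
  - by rewrite pset_other // aux_inj.
rewrite pset_same pset_pset; apply: runs_to (IH _).
by congr (pset _ _ _); rewrite !PoszD (intS (size xs)) (intS (nth _ _ _)); ring.
Qed.

Definition steps (n : nat) (d : direction) : dev :=
  iter n (fun K => mv ruler d ;; K) (ret true).

Lemma runs_steps n d env k C :
  runs (steps n d) (pset ruler k (posof env), C) true
    (pset ruler (k + n%:Z * dir_int d)%R (posof env), C) n.+1.
Proof.
elim: n k => [|n IH] k /=; first by rewrite mul0r addr0; apply: runs_ret.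
apply: (@runs_seq _ _ _ _ _ _ _ _ _ 1); first exact: runs_mv.
rewrite pset_same pset_pset; apply: runs_to (IH _).
by congr (pset _ _ _); rewrite (intS n); ring.
Qed.

Definition opposite (d : direction) : direction :=
  match d with MoveL => MoveR | Stay => Stay | MoveR => MoveL end.

(* sweep moves by one more than the value of each variable, hence the
   corrections by size ys and size xs. *)
Definition sum_goto xs a ys d : dev :=
  sweep xs d ;; sweep ys (opposite d) ;;
  steps (a + size ys) d ;; steps (size xs) (opposite d).

Definition sum_time (xs : seq nat) (a : nat) (ys : seq nat) (n : nat) : nat :=
  (size xs * (n * 7 + 6) + 1) + ((size ys * (n * 7 + 6) + 1) +
    ((a + size ys).+1 + (size xs).+1)).

Lemma runs_sum_goto xs a ys d env k C : good C -> all (fun v => v < N) env ->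
  size env <= V.+1 -> all (fun x => x < size env) xs ->
  all (fun x => x < size env) ys ->
  runs (sum_goto xs a ys d) (pset ruler k (posof env), C) true
    (pset ruler (k + ((sumn (map (nth 0 env) xs) + a)%:Z
        - (sumn (map (nth 0 env) ys))%:Z) * dir_int d)%R (posof env), C)
    (sum_time xs a ys N).
Proof.
move=> gC Henv sV Hx Hy.
apply: runs_seq; first exact: runs_sweep.
apply: runs_seq; first exact: runs_sweep.
apply: runs_seq; first exact: runs_steps.
apply: runs_to; last exact: runs_steps.
congr (pset _ _ _); rewrite !PoszD; case: d => /=; ring.
Qed.

(** Undoing the movement in both branches makes the evaluation of a formula leave the memory
    unchanged. *)
Definition probe (i : I) (go back : dev) : dev :=
  go ;; If rd (@is_some _) i Then (back ;; ret true) Else (back ;; ret false).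

Lemma runs_probe i go back C p p' t :
  runs go (p, C) true (p', C) t -> runs back (p', C) true (p, C) t ->
  runs (probe i go back) (p, C) (C i (p' i)) (p, C) (2 * t + 2).
Proof.
move=> Hgo Hback.
apply: (@runs_le _ _ _ _ _ _ (t + (1 + (t + 1)))); first lia.
apply: runs_seq; first exact: Hgo.
apply: runs_bind; first exact: runs_rd.
rewrite /is_some; case: (C i (p' i)) => [s|] /=;
  by apply: runs_seq; first exact: Hback; exact: runs_ret.
Qed.

(** The loop ends on a witness or on the blank at [N]; the cell under the head tells which. *)
Definition search (x : I) (D : dev) : dev :=
  while_nonblank x (If D Then ret false Else mv x MoveR) ;;
  If rd (@is_some _) x Then (rewind x ;; ret true) Else (rewind x ;; ret false).

Fixpoint satD (d : nat) (phi : fml) : dev :=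
  match phi with
  | Letter f x => rd (fun s => if s is Some (inl a) then f a else false) (vt x)
  | Sum xs a ys =>
      probe ruler (sum_goto xs a ys MoveR) (sum_goto xs a ys MoveL)
  | Rel r x y z => probe (rt r) (goto r x y z MoveR) (goto r x y z MoveL)
  | Neg phi => bind (satD d phi) (fun b => ret (~~ b))
  | Conj phi psi => If satD d phi Then satD d psi Else ret false
  | Ex phi => search (vt d) (satD d.+1 phi)
  end.

Fixpoint sat_time (phi : fml) (n : nat) : nat :=
  match phi with
  | Letter f x => 1
  | Sum xs a ys => 2 * sum_time xs a ys n + 2
  | Rel r x y z => 2 * goto_time n + 2
  | Neg phi => sat_time phi n + 1
  | Conj phi psi => sat_time phi n + (sat_time psi n + 1)
  | Ex phi => n * (sat_time phi n + 2) + (sat_time phi n + 2 * n + 10)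
  end.

Lemma poly_bounded_goto : poly_bounded goto_time.
Proof. rewrite /goto_time; polyb. Qed.

Lemma poly_bounded_sat phi : poly_bounded (sat_time phi).
Proof.
have Hg := poly_bounded_goto.
elim: phi => [f x|xs a ys|r x y z|phi IH|phi IH1 psi IH2|phi IH] /=; polyb.
Qed.

Lemma runs_satD phi d env C : wf d phi -> d <= V.+1 -> size env = d ->
  all (fun v => v < N) env -> good C ->
  runs (satD d phi) (posof env, C) (sat w (relof C) env phi) (posof env, C)
    (sat_time phi N).
Proof.
move=> + + + + gC; case: (gC) => gv ga gr.
have pset0 e i : posof e i = 0%R -> pset i 0 (posof e) = posof e.
  by move=> <-; rewrite pset_id.
elim: phi d env => [f x|xs a ys|r x y z|phi IH|phi IH1 psi IH2|phi IH] d env /=.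
- move=> xd dV se Henv; have Hx : x <= V by lia.
  have := runs_rd (fun s : option G => if s is Some (inl a) then f a else false)
    (vt x) (posof env) C.
  rewrite posof_vt // gv /= /letter.
  by case: (onth w _).
- case/andP=> Hx Hy dV se Henv; rewrite -se in Hx Hy dV.
  have H1 := runs_sum_goto a MoveR 0 gC Henv dV Hx Hy.
  have := runs_sum_goto a MoveL _ gC Henv dV Hx Hy.
  set e := (Posz (_ + a)%N - Posz _)%R in H1 *.
  rewrite pset0 // in H1 * => H2; have {}H2 := H2 (0 + e * dir_int MoveR)%R.
  rewrite (_ : 0 + e * _ + e * _ = 0)%R in H2; last by rewrite /=; ring.
  rewrite pset0 // in H2; have := runs_probe ruler H1 H2.
  rewrite pset_same gr; congr runs.
  rewrite /e /= mulr1 add0r subr_eq0 //.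
- case/and4P=> rR xd yd zd dV se Henv; rewrite -se in xd yd zd dV.
  have H1 := runs_goto r MoveR 0 gC Henv dV xd yd zd.
  have H2 := runs_goto r MoveL _ gC Henv dV xd yd zd.
  set e := addr _ _ _ in H1 H2.
  rewrite pset0 // in H1; have {}H2 := H2 (0 + e%:Z * dir_int MoveR)%R.
  rewrite (_ : 0 + e%:Z * _ + e%:Z * _ = 0)%R in H2; last by rewrite /=; ring.
  rewrite pset0 // in H2; have := runs_probe (rt r) H1 H2.
  by rewrite pset_same (_ : 0 + e%:Z * _ = Posz e)%R //= add0r mulr1.
- by move=> Hw dV se Henv; apply: runs_bind; [exact: IH|exact: runs_ret].
- case/andP=> Hw1 Hw2 dV se Henv.
  apply: runs_bind; first exact: (IH1 d).
  case: ifP => _ /=; last by apply: runs_le (runs_ret _ _ _); lia.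
  by apply: runs_le (IH2 _ _ Hw2 dV se Henv); lia.
- case/andP=> dV Hw _ se Henv; set psi := fun v => sat _ _ _ _.
  set T := sat_time phi N in IH *.
  have rdx v : C (vt d) (posof (rcons env v) (vt d)) = (v < N) :> bool.
    by rewrite (posof_rcons _ se) // pset_same gv word_tape_Posz.
  have body v : v < N ->
      runs (satD d.+1 phi) (posof (rcons env v), C) (psi v) (posof (rcons env v), C) T.
    by move=> vN; apply: IH; rewrite ?size_rcons ?se ?all_rcons ?vN.
  (* Here [u] positions are still to be tried, and [v] is where the head stops: at a witness, or at
     [N] if there is none. *)
  have loopP u : u <= N -> exists v, [/\ v <= N, (v < N) = has psi (iota (N - u) u)
      & runs (while_nonblank (vt d) (If satD d.+1 phi Then ret false Else mv (vt d) MoveR))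
          (posof (rcons env (N - u)), C) false (posof (rcons env v), C)
          (u * (T + 2) + T + 2)].
    elim: u => [|u IHu] uN.
      exists N; rewrite subn0 ltnn; split=> //=.
      by apply: (@runs_le _ _ _ _ _ _ 2); [lia|apply: while_stop; rewrite rdx ltnn].
    have vN : N - u.+1 < N by lia.
    have bodyv := body _ vN; rewrite /= (_ : (N - u.+1).+1 = N - u); last lia.
    case psiv: (psi (N - u.+1)) bodyv => bodyv /=.
      exists (N - u.+1); rewrite vN; split=> //; first lia.
      apply: runs_loop_stop.
      apply: (@runs_le _ _ _ _ _ _ (1 + (T + 1))); first lia.
      apply: runs_bind; first exact: runs_rd.
      rewrite /is_some rdx vN; apply: runs_bind; first exact: bodyv.
      exact: runs_ret.
    have [v [v_N vE run]] := IHu (ltnW uN); exists v; split=> //.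
    apply: (@runs_le _ _ _ _ _ _ ((T + 1).+1 + (u * (T + 2) + T + 2))).
      by rewrite mulSn; lia.
    apply: while_step run; first by rewrite rdx.
    apply: runs_bind; first exact: bodyv.
    apply: runs_to; last exact: runs_mv.
    rewrite !(posof_rcons _ se) // pset_pset pset_same; congr (pset _ _ _).
    by rewrite /=; lia.
  have [v [vN vE run]] := loopP N (leqnn _).
  rewrite subnn in vE run; rewrite -vE.
  (* The tape of the new variable rests at 0, so the search starts as if the variable already had
     the value 0. *)
  have env0 : posof env = posof (rcons env 0).
    by rewrite (posof_rcons _ se) // pset0 // posof_vt // nth_default ?se.
  rewrite {1}env0.
  apply: (@runs_le _ _ _ _ _ _ ((N * (T + 2) + T + 2) + (1 + ((2 * N + 4) + 1)))).
    lia.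
  apply: runs_seq; first exact: run.
  have Hr : runs (rewind (vt d)) (posof (rcons env v), C) true (posof env, C) (2 * N + 4).
    apply: runs_to; last by apply: runs_rewind (gv _) vN _; rewrite (posof_rcons _ se) // pset_same.
    rewrite (posof_rcons _ se) // pset_pset pset0 //.
    by rewrite posof_vt // nth_default ?se.
  apply: runs_bind; first exact: runs_rd.
  rewrite /is_some rdx; case: (v < N);
    by apply: runs_seq; [exact: Hr | exact: runs_ret].
Qed.

Definition sweep_down (x : I) (D : dev) : dev :=
  scan x MoveR ;; mv x MoveL ;; while_nonblank x (D ;; mv x MoveL) ;; mv x MoveR.

(** [Inv v] is meant to say that the values from [v] on have been processed. *)
Lemma runs_sweep_down d env D t (Inv : nat -> (I -> int -> option G) -> Prop) :
  size env = d -> d <= V -> (forall v C, Inv v C -> good C) ->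
  (forall v C, v < N -> Inv v.+1 C -> exists C' b,
     runs D (posof (rcons env v), C) b (posof (rcons env v), C') t /\ Inv v C') ->
  forall C, Inv N C -> exists C',
    runs (sweep_down (vt d) D) (posof env, C) true (posof env, C')
      (N * (t + 2) + 2 * N + 6) /\ Inv 0 C'.
Proof.
move=> se dV Hgood HD C IC.
have [gv _ _] := Hgood _ _ IC.
have Ed v : posof (rcons env v) = pset (vt d) (Posz v) (posof env).
  by rewrite (posof_rcons _ se).
have loopP v C1 : v <= N -> Inv v C1 -> exists C',
    runs (while_nonblank (vt d) (D ;; mv (vt d) MoveL))
      (pset (vt d) (v%:Z - 1)%R (posof env), C1) false
      (pset (vt d) (-1)%R (posof env), C') (v * (t + 2) + 2) /\ Inv 0 C'.
  elim: v C1 => [|v IH] C1 vN I1; have [gv1 _ _] := Hgood _ _ I1.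
    by exists C1; split=> //; apply: while_stop; rewrite gv1 pset_same.
  have [C2 [b [run2 I2]]] := HD _ _ vN I1.
  have [C' [run' I']] := IH _ (ltnW vN) I2; exists C'; split=> //.
  apply: (@runs_le _ _ _ _ _ _ ((t + 1).+1 + (v * (t + 2) + 2))); first lia.
  rewrite (_ : v.+1%:Z - 1 = v)%R; last lia.
  apply: while_step run'; first by rewrite gv1 pset_same word_tape_Posz.
  rewrite -Ed; apply: runs_seq; first exact: run2.
  apply: runs_to; last exact: runs_mv.
  by rewrite Ed pset_pset pset_same.
have [C' [run' I']] := loopP N C (leqnn _) IC; exists C'; split=> //.
have [gv' _ _] := Hgood _ _ I'.
apply: (@runs_le _ _ _ _ _ _ ((2 * N + 2) + (1 + ((N * (t + 2) + 2) + 1)))); first lia.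
have p0 : posof env (vt d) = 0%R by rewrite posof_vt // nth_default ?se.
apply: runs_seq; first by apply: (runs_scanR (gv _) (leqnn _)); rewrite p0 subrr.
apply: runs_seq; first exact: runs_mv.
rewrite pset_pset pset_same; apply: runs_seq; first exact: run'.
apply: runs_to; last exact: runs_mv.
by rewrite pset_pset pset_same -[RHS](pset_id (vt d)) p0.
Qed.

Definition setC C r x y z (b : bool) : I -> int -> option G :=
  fun j => if j == rt r
    then upd (C (rt r)) (Posz (addr x y z)) (if b then Some (inr tt) else None)
    else C j.

Lemma good_setC C r x y z b : good C -> good (setC C r x y z b).
Proof. by case. Qed.

Lemma relof_setC C r x y z b s x' y' z' : r <= R -> s <= R ->
  x < N -> y < N -> z < N -> x' < N -> y' < N -> z' < N ->
  relof (setC C r x y z b) s x' y' z' =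
    if [&& s == r, x' == x, y' == y & z' == z] then b else relof C s x' y' z'.
Proof.
move=> rR sR xN yN zN x'N y'N z'N; rewrite /relof /setC rt_inj //.
case: eqP => [->|] //=; rewrite /upd; case: eqP => [/(congr1 absz) e|ne].
  have [-> -> ->] := addr_inj x'N y'N z'N xN yN zN e.
  by rewrite !eqxx; case: b.
by case: and3P => // -[/eqP e1 /eqP e2 /eqP e3]; case: ne; rewrite e1 e2 e3.
Qed.

Definition setD (r : nat) (phi : fml) : dev :=
  bind (satD 3 phi) (fun b => goto r 0 1 2 MoveR ;;
    wr (rt r) (if b then Some (inr tt) else None) ;; goto r 0 1 2 MoveL).

Definition set_time (phi : fml) (n : nat) : nat :=
  sat_time phi n + (goto_time n + (1 + goto_time n)).

Lemma runs_setD r phi C x y z : 2 <= V -> wf 3 phi -> x < N -> y < N -> z < N -> good C ->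
  runs (setD r phi) (posof [:: x; y; z], C) true
    (posof [:: x; y; z], setC C r x y z (sat w (relof C) [:: x; y; z] phi))
    (set_time phi N).
Proof.
move=> V3 Hw xN yN zN gC.
have Henv : all (fun v => v < N) [:: x; y; z] by rewrite /= xN yN zN.
set env := [:: x; y; z] in Henv *.
have p0 : pset (rt r) 0 (posof env) = posof env.
  by apply: functional_extensionality => j; rewrite /pset; case: eqP => [->|].
have H1 d k C1 : good C1 -> _ := fun gC1 =>
  @runs_goto r 0 1 2 d env k C1 gC1 Henv V3 isT isT isT.
apply: runs_bind; first by apply: (runs_satD Hw).
set b := sat _ _ _ _.
apply: runs_seq; first by rewrite -p0; apply: H1.
apply: runs_seq; first exact: runs_wr.
apply: runs_to; last first.
  rewrite (_ : (fun j => _) = setC C r x y z b); first exact: H1 (good_setC _ _ _ _ _ gC).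
  apply: functional_extensionality => j; rewrite /setC; case: eqP => // _.
  by rewrite pset_same /= add0r mulr1.
by rewrite -[RHS]p0; congr (pset _ _ _); rewrite /=; ring.
Qed.

Definition defD (r : nat) (phi : fml) : dev :=
  sweep_down (vt 0) (sweep_down (vt 1) (sweep_down (vt 2) (setD r phi))).

Definition def_time (phi : fml) (n : nat) : nat :=
  let loop_time t := n * (t + 2) + 2 * n + 6 in
  loop_time (loop_time (loop_time (set_time phi n))).

Lemma poly_bounded_def phi : poly_bounded (def_time phi).
Proof.
have Hg := poly_bounded_goto; have Hs := poly_bounded_sat phi.
rewrite /def_time /set_time; polyb.
Qed.

(** A semantic form of well-foundedness: at first argument [x] the formula sees [r] only at first
    arguments above [x], so its defining equation can be solved by descent on [x]. *)
Definition guarded (r : nat) (phi : fml) : Prop :=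
  forall x y z (rho rho' : nat -> nat -> nat -> nat -> bool),
    x < N -> y < N -> z < N ->
    (forall s a b c, s <= R -> s != r -> a < N -> b < N -> c < N ->
       rho s a b c = rho' s a b c) ->
    (forall a b c, x < a -> a < N -> b < N -> c < N -> rho r a b c = rho' r a b c) ->
    sat w rho [:: x; y; z] phi = sat w rho' [:: x; y; z] phi.

(** Triples are treated in descending lexicographic order, so every bit that a guarded formula reads
    is final by then. The old contents of [r] are overwritten, and the new ones satisfy the equation
    on all positions. *)
Lemma runs_defD r phi C0 : 2 <= V -> r <= R -> wf 3 phi -> guarded r phi -> good C0 ->
  exists C, [/\ runs (defD r phi) (posof [::], C0) true (posof [::], C) (def_time phi N),
    good C,
    forall s x y z, s <= R -> s != r -> x < N -> y < N -> z < N ->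
      relof C s x y z = relof C0 s x y z
  & forall x y z, x < N -> y < N -> z < N ->
      relof C r x y z = sat w (relof C) [:: x; y; z] phi].
Proof.
move=> V2 rR Hw Hg gC0.
pose done (P : nat -> nat -> nat -> bool) C :=
  [/\ good C,
    forall s x y z, s <= R -> s != r -> x < N -> y < N -> z < N ->
      relof C s x y z = relof C0 s x y z
  & forall x y z, x < N -> y < N -> z < N -> P x y z ->
      relof C r x y z = sat w (relof C) [:: x; y; z] phi].
have done_good P C : done P C -> good C by case.
have doneW (P Q : nat -> nat -> nat -> bool) C :
    (forall x y z, x < N -> y < N -> z < N -> Q x y z -> P x y z) ->
    done P C -> done Q C.
  by move=> QP [gC fr H]; split=> // x y z xN yN zN /QP HP; apply: H => //; apply: HP.
(* [P0], [P1] and [P2] select the triples already final in the outer, middle and inner sweep: those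
   lexicographically at or above the point reached. *)
pose P0 v := fun x y z : nat => v <= x.
pose P1 x0 v := fun x y z : nat => (x0 < x) || (x == x0) && (v <= y).
pose P2 x0 y0 v := fun x y z =>
  (x0 < x) || (x == x0) && ((y0 < y) || (y == y0) && (v <= z)).
have step x y z C : x < N -> y < N -> z < N -> done (P2 x y z.+1) C ->
    exists C' b, runs (setD r phi) (posof [:: x; y; z], C) b
      (posof [:: x; y; z], C') (set_time phi N) /\ done (P2 x y z) C'.
  move=> xN yN zN [gC fr H].
  exists (setC C r x y z (sat w (relof C) [:: x; y; z] phi)), true; split.
    exact: runs_setD.
  (* Writing the bit at [(x, y, z)] does not invalidate equations established before: at a first
     argument [x'] with [x <= x'] the formula reads [r] only beyond [x'], hence not at [x]. *)
  have guardE x' y' z' : x <= x' -> x' < N -> y' < N -> z' < N ->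
      sat w (relof (setC C r x y z (sat w (relof C) [:: x; y; z] phi)))
        [:: x'; y'; z'] phi = sat w (relof C) [:: x'; y'; z'] phi.
    move=> xx' x'N y'N z'N; apply: Hg => // [s a b c sR sr aN bN cN|a b c xa aN bN cN].
      by rewrite relof_setC // (negbTE sr).
    by rewrite relof_setC // eqxx /= gtn_eqF //; apply: leq_ltn_trans xa.
  split; first exact: good_setC.
    by move=> s a b c sR sr aN bN cN; rewrite relof_setC // (negbTE sr) /= fr.
  move=> a b c aN bN cN HP; rewrite guardE //; last by move: HP; rewrite /P2; lia.
  rewrite relof_setC // eqxx /=; case: and3P => [[/eqP-> /eqP-> /eqP->] //|ne].
  apply: H => //; move: HP ne; rewrite /P2 => HP ne.
  case: (ltngtP x a) HP ne => //= xa; rewrite ?orbF ?xa ?eqxx //=.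
  case: (ltngtP y b) => //= yb; rewrite ?yb ?eqxx //= => zc ne.
  by rewrite ltn_neqAle zc andbT; apply: contraPneq ne => ->; case; split.
pose T t := N * (t + 2) + 2 * N + 6.
have step2 x y C : x < N -> y < N -> done (P1 x y.+1) C ->
    exists C' b, runs (sweep_down (vt 2) (setD r phi)) (posof [:: x; y], C) b
      (posof [:: x; y], C') (T (set_time phi N)) /\ done (P1 x y) C'.
  move=> xN yN dC.
  have [|C' [run dC']] := runs_sweep_down (env := [:: x; y]) erefl V2
    (fun v => @done_good (P2 x y v)) (fun z C zN => step x y z C xN yN zN) (C := C).
    by apply: doneW dC => a b c aN bN cN; rewrite /P1 /P2; lia.
  exists C', true; split; first exact: run.
  by apply: doneW dC' => a b c aN bN cN; rewrite /P1 /P2; lia.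
have step1 x C : x < N -> done (P0 x.+1) C ->
    exists C' b, runs (sweep_down (vt 1) (sweep_down (vt 2) (setD r phi)))
      (posof [:: x], C) b (posof [:: x], C') (T (T (set_time phi N))) /\ done (P0 x) C'.
  move=> xN dC.
  have [|C' [run dC']] := runs_sweep_down (env := [:: x]) erefl (ltnW V2)
    (fun v => @done_good (P1 x v)) (fun y C yN => step2 x y C xN yN) (C := C).
    by apply: doneW dC => a b c aN bN cN; rewrite /P1 /P0; lia.
  exists C', true; split; first exact: run.
  by apply: doneW dC' => a b c aN bN cN; rewrite /P1 /P0; lia.
have [|C [run dC]] := runs_sweep_down (env := [::]) erefl isT
    (fun v => @done_good (P0 v)) step1 (C := C0).
  by split=> // x y z xN _ _; rewrite /P0 leqNgt xN.
case: dC => gC fr H; exists C; split=> //; move=> x y z xN yN zN; exact: H.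
Qed.

End Formula.

(** * From a list of definitions and a final formula to a polynomial-time machine *)

Section Program.
Variables (A : finType) (V R : nat).
Notation J := (tapes V R).
Notation I := (option J).
Notation G := (A + unit)%type.
Notation dev := (dev I G).

(** The tapes that carry the input or a copy of it; their heads move together during
    initialisation. *)
Definition word_like (i : I) : bool :=
  match i with
  | None | Some (inl (inl _)) => true
  | Some (inl (inr _)) => false
  | Some (inr j) => val j < 3
  end.

Definition copy : dev := atom (fun=> true)
  (fun v i => if word_like i then (v None, MoveR) else (v i, Stay)).

Definition shift (d : direction) : dev := atom (fun=> true)
  (fun v i => (v i, if word_like i then d else Stay)).

Definition init : dev :=
  wr (ruler V R) (Some (inr tt)) ;; while_nonblank None copy ;;
  shift MoveL ;; while_nonblank None (shift MoveL) ;; shift MoveR.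

Section Init.
Variable w : seq A.
Notation N := (size w).

Definition heads (z : int) (i : I) : int := if word_like i then z else 0%R.

Definition copied (k : int) (i : I) (z : int) : option G :=
  match i with
  | None => word_tape w z
  | Some (inl (inr _)) => None
  | _ => if word_like i then if (z < k)%R then word_tape w z else None
         else if z == 0%R then Some (inr tt) else None
  end.

Lemma runs_shift d z C :
  runs (shift d) (heads z, C) true (heads (z + dir_int d)%R, C) 1.
Proof.
split=> //; congr pair; apply: functional_extensionality => j /=.
  by rewrite /heads; case: (word_like j) => //=; rewrite addr0.
by rewrite /view /= upd_id.
Qed.

Lemma good_copied : good w (copied N).
Proof.
split=> [x|j j3|z]; last 1 first.
- by rewrite /= inordK //=; case: (z == 0%R).
- apply: functional_extensionality => z /=.
  case: ltrP => // zN; case E: (word_tape w z) => //.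
  by have := @word_tape_out _ w z; rewrite E; case: andP => [[]|_ /(_ isT)] //; lia.
have j4 := ltnW j3; apply: functional_extensionality => z /=.
rewrite [inord j < 3](_ : _ = true); last by rewrite inordK.
case: ltrP => // zN; case E: (word_tape w z) => //.
by have := @word_tape_out _ w z; rewrite E; case: andP => [[]|_ /(_ isT)] //; lia.
Qed.

Lemma runs_init : runs init (input_mem J unit w) true (posof [::], copied N) (6 * N + 8).
Proof.
have heads0 : heads 0 = posof [::].
  apply: functional_extensionality => -[[[x|r]|j]|] //=; rewrite /heads.
    by rewrite nth_nil.
  by case: ifP.
apply: (@runs_le _ _ _ _ _ _ (1 + ((3 * N + 2) + (1 + ((3 * N + 2) + 1))))); first lia.
apply: runs_seq; first exact: runs_wr.
set C0 := fun j : I => if _ then _ else _; have -> : C0 = copied 0.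
  apply: functional_extensionality => -[[[x|r]|j]|]; apply: functional_extensionality => z //=.
  - by case: ltrP => // z0; case: z z0.
  - rewrite /C0; case: eqP => [[->]|jr]; rewrite /upd /=.
      by rewrite inordK.
    case: ifP => j3; first by case: ltrP => // z0; case: z z0.
    case: jr; congr (Some (inr _)); apply: val_inj; rewrite /= inordK //.
    by apply/eqP; rewrite eqn_leq -ltnS ltn_ord leqNgt j3.
rewrite (_ : (fun=> 0%R) = heads 0); last first.
  by apply: functional_extensionality => i; rewrite /heads; case: ifP.
have copyP k : k <= N -> runs (while_nonblank None copy)
    (heads (N%:Z - k%:Z)%R, copied (N%:Z - k%:Z)%R) false (heads N, copied N) (3 * k + 2).
  elim: k => [|k IH] kN.
    by rewrite subr0; apply: while_stop; apply: (@word_tape_out _ w N); lia.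
  apply: (@runs_le _ _ _ _ _ _ (1.+1 + (3 * k + 2))); first lia.
  apply: while_step (IH (ltnW kN)).
    by apply: (@word_tape_in _ w (N%:Z - k.+1%:Z)); lia.
  split=> //; congr pair; apply: functional_extensionality => i /=.
    by rewrite /heads; case: (word_like i) => /=; lia.
  apply: functional_extensionality => z.
  case: i => [[[x|r]|j]|]; rewrite /upd /view /heads /= ?if_same //.
  - case: eqP => [->|ne]; first by rewrite (_ : _ < _)%R //; lia.
    by congr (if _ then _ else _); lia.
  - case j3: (val j < 3) => /=; last by case: eqP.
    case: eqP => [->|ne]; first by rewrite (_ : _ < _)%R //; lia.
    by congr (if _ then _ else _); lia.
  - by case: eqP => [->|].
have backP k : k <= N -> runs (while_nonblank None (shift MoveL))
    (heads (k%:Z - 1)%R, copied N) false (heads (-1), copied N) (3 * k + 2).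
  elim: k => [|k IH] kN; first exact: while_stop.
  apply: (@runs_le _ _ _ _ _ _ (1.+1 + (3 * k + 2))); first lia.
  apply: while_step (IH (ltnW kN)).
    by apply: (@word_tape_in _ w (k.+1%:Z - 1)); lia.
  by rewrite (_ : k%:Z - 1 = (k.+1%:Z - 1) + dir_int MoveL)%R;
    [apply: runs_shift | rewrite /=; lia].
have := copyP N (leqnn _); rewrite subrr => run_copy.
apply: runs_seq; first exact: run_copy.
apply: runs_seq; first exact: runs_shift.
apply: runs_seq; first exact: (backP N).
by rewrite -heads0; apply: (runs_shift MoveR (-1)).
Qed.

End Init.

Definition rels : Type := nat -> nat -> nat -> nat -> bool.

Definition agree_off (r : nat) (n : nat) (rho rho' : rels) : Prop :=
  forall s x y z, s <= R -> s != r -> x < n -> y < n -> z < n ->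
    rho s x y z = rho' s x y z.

(* The weakest condition on the initial contents rho of the relations for Q to
   hold of their final contents. *)
Fixpoint after (w : seq A) (defs : seq (nat * fml A)) (Q : rels -> Prop)
    (rho : rels) : Prop :=
  if defs is (r, phi) :: defs' then
    forall rho' : rels, agree_off r (size w) rho' rho ->
      (forall x y z, x < size w -> y < size w -> z < size w ->
         rho' r x y z = sat w rho' [:: x; y; z] phi) ->
      after w defs' Q rho'
  else Q rho.

Fixpoint well_defined (w : seq A) (defs : seq (nat * fml A)) : Prop :=
  if defs is (r, phi) :: defs' then
    [/\ r <= R, wf V R 3 phi, guarded R w r phi & well_defined w defs']
  else True.

Definition programD (defs : seq (nat * fml A)) (phi : fml A) : dev :=
  init ;; foldr (fun d K => defD V R d.1 d.2 ;; K) (satD V R 0 phi) defs.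

(** The interface to the machine model: it remains to define the language by formulas. *)
Lemma program_polytime defs phi (L : seq A -> Prop) :
  2 <= V -> wf V R 0 phi -> (forall w, well_defined w defs) ->
  (forall w rho, after w defs (fun rho' => sat w rho' [::] phi <-> L w) rho) ->
  polytime_language L.
Proof.
move=> V2 Hphi Hdefs HL.
pose tm n := foldr (fun d t => def_time d.2 n + t) (sat_time phi n) defs.
have [p Hp] : poly_bounded (fun n => (6 * n + 8) + tm n).
  polyb; rewrite /tm; elim: (defs) => [|d ds IH] /=; first exact: poly_bounded_sat.
  by apply: poly_bounded_add; first exact: poly_bounded_def.
exists (dev_TM (programD defs phi)), p => w.
suff body C : good w C -> exists b m',
    runs (foldr (fun d K => defD V R d.1 d.2 ;; K) (satD V R 0 phi) defs)
      (posof [::], C) b m' (tm (size w)) /\ (b <-> L w).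
  have [b [m' [run HbL]]] := body _ (good_copied w).
  exists b => //; apply: dev_TM_halts; apply: runs_le (Hp _) _.
  by apply: runs_seq run; apply: runs_init.
rewrite /tm; move: (Hdefs w) (HL w (relof w C)).
elim: (defs) C => [|[r psi] ds IH] C /=.
  move=> _ HQ gC; exists (sat w (relof w C) [::] phi), (posof [::], C); split=> //.
  exact: runs_satD.
case=> rR Hpsi Hg Hds HQ gC.
have [C' [run gC' fr eq]] := runs_defD V2 rR Hpsi Hg gC.
have [|b [m' [run' Hb]]] := IH C' Hds _ gC'; first exact: HQ.
by exists b, m'; split=> //; apply: runs_seq run run'.
Qed.

End Program.

(** * The game on the infinite path *)

Definition is_ge2 (q : quantifier) : bool :=
  if q is ExistsGe2 then true else false.

(** Two witnesses, distinct only when required, allow both quantifiers to be treated at once. *)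
Lemma exists_at_leastP (T : eqType) (q : quantifier) (P : T -> Prop) :
  exists_at_least (threshold q) P <->
  exists a b, [/\ P a, P b & is_ge2 q -> a <> b].
Proof.
case: q; split=> /=.
- by case=> f _ Pf; exists (f ord0), (f ord0).
- by case=> a [b [Pa _ _]]; exists (fun=> a) => // i j _; rewrite !ord1.
- case=> f inj_f Pf; exists (f ord0), (f ord_max); split=> // _.
  by move/inj_f.
- case=> a [b [Pa Pb /(_ isT) ab]].
  exists (fun i : 'I_2 => if i == ord0 then a else b).
    move=> i j; case: (eqVneq i ord0) => [->|i0]; case: (eqVneq j ord0) => [->|j0] //.
    - by move/esym.
    - move=> _; apply: val_inj; move: i0 j0; rewrite -!val_eqE /=.
      by case: i => [[|[|]]] //; case: j => [[|[|]]].
  by move=> i; case: ifP.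
Qed.

Lemma nth_eq_rcons (T : Type) (x0 : T) s a i :
  nth x0 (rcons s a) i = if i == size s then a else nth x0 s i.
Proof.
rewrite nth_rcons; case: ltngtP => //= h.
by rewrite nth_default // ltnW.
Qed.

Section Game.
Variables (m N : nat) (qs : seq quantifier) (ed : rel nat).
Variables (D W : nat -> nat -> nat -> bool) (P : seq int -> Prop).
Notation ge2 x := (is_ge2 (nth ExistsGe1 qs x)).

Hypothesis mN : m <= N.
Hypothesis size_qs : size qs = m.
Hypothesis edC : symmetric ed.
Hypothesis ed_m : forall u v, ed u v -> u < m /\ v < m.
Hypothesis ed_N : forall u v, ed u v -> 1 < N.
Hypothesis PE : forall vs, size vs = m ->
  (P vs <-> forall u v, ed u v -> `|nth 0 vs u - nth 0 vs v|%R = 1%R).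
(** The elimination rule. The term [2 * ge2 x] stands on the left to avoid truncated subtraction, so
    a negative bound gives no [k] at all. The bound 1 of an edge must itself be below [N], which is
    what [ed_N] provides. *)
Hypothesis DE : forall v u k, v < N -> u < N -> k < N ->
  (D v u k <-> u <= v /\ ((ed u v /\ k = 1) \/ exists x k1 k2,
     [/\ v < x < m, k1 < N, k2 < N, D x u k1 & D x v k2] /\
     k + 2 * ge2 x = k1 + k2)).
(** The third argument is a position read as a bit, zero or nonzero: the parity of a walk from [u]
    to [v]. *)
Hypothesis WE : forall v u b, v < N -> u < N -> b < N ->
  (W v u b <-> u <= v /\ ((ed u v /\ b != 0) \/ exists x b1 b2,
     [/\ v < x < m, b1 < N, b2 < N, W x u b1 & W x v b2] /\
     (b != 0) = (b1 != 0) (+) (b2 != 0))).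

Definition Win (vs : seq int) : Prop := quantify (drop (size vs) qs) vs P.

Lemma Win_step vs : size vs < m -> Win vs <->
  exists a b, [/\ Win (rcons vs a), Win (rcons vs b)
    & ge2 (size vs) -> a <> b].
Proof.
move=> vm; rewrite /Win (drop_nth ExistsGe1) ?size_qs //=.
by rewrite exists_at_leastP; split=> -[a [b H]]; exists a, b;
   move: H; rewrite !size_rcons.
Qed.

Lemma Win_end vs : size vs = m -> Win vs <-> P vs.
Proof. by move=> vm; rewrite /Win drop_oversize // size_qs vm. Qed.

(** Playing on leaves the earlier values unchanged; this is how later variables reveal constraints
    on earlier ones. *)
Lemma Win_extend vs j : size vs <= j <= m -> Win vs ->
  exists vs', [/\ size vs' = j, Win vs' &
    forall i, i < size vs -> nth 0%R vs' i = nth 0%R vs i].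
Proof.
have [n] := ubnP (j - size vs); elim: n vs => // n IH vs jn /andP[vj jm] HW.
case: (ltngtP (size vs) j) vj => // [vj _|<- _]; last by exists vs.
have [a [b [Ha _ _]]] := (Win_step (leq_trans vj jm)).1 HW.
have [||//|vs' [sz HW' eqs]] := IH (rcons vs a); rewrite ?size_rcons ?vj //; first lia.
exists vs'; split=> // i ivs.
by rewrite eqs ?size_rcons 1?ltnW // nth_rcons ivs.
Qed.

(** * Parity, and soundness of the derived constraints *)

Definition zodd (z : int) : bool := odd `|z|%N.

Lemma zoddD x y : zodd (x + y) = zodd x (+) zodd y.
Proof. by rewrite /zodd; lia. Qed.

Lemma zoddN x : zodd (- x) = zodd x.
Proof. by rewrite /zodd abszN. Qed.

Lemma zodd_dist x y : zodd (x - y) = false -> x <> y -> (2 <= `|x - y|)%R.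
Proof.
rewrite /zodd => p ne; have : `|x - y|%N <> 0%N by lia.
by rewrite -abszE; case: `|x - y|%N p => [|[|n]].
Qed.

(** Induction from the last variable down. For a constraint derived through [x], play on up to [x]:
    both winning values a and b of [x] satisfy the constraints with [u] and [v], and the triangle
    inequality gives k1 + k2. If a and b differ, they have the same parity and so are at least 2
    apart; bounding one side through a and the other through b saves 2. *)
Lemma sound_step v vs : size vs = v.+1 -> v < m -> Win vs ->
  forall u k, u < N -> k < N -> 
  (D v u k -> (`|nth 0 vs u - nth 0 vs v| <= k%:Z)%R /\
     zodd (nth 0 vs u - nth 0 vs v)%R = odd k) /\
  (W v u k -> zodd (nth 0 vs u - nth 0 vs v)%R = (k != 0)).
Proof.
have [n] := ubnP (m - v); elim: n v vs => // n IH v vs vn sz vm HW u k uN kN.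
have vN := leq_trans vm mN.
have edge : ed u v -> u <= v -> (`|nth 0 vs u - nth 0 vs v| = 1)%R.
  move=> euv uv; have [|vs' [sz' HW' eqs]] := @Win_extend vs m _ HW; first by lia.
  have [Hedge _] := PE sz'; have := Hedge ((Win_end sz').1 HW') u v euv.
  by rewrite !eqs ?sz.
have split_at x : v < x < m -> u <= v -> exists a b,
    [/\ ge2 x -> a <> b & forall c, c = a \/ c = b -> forall k, k < N ->
      [/\ D x u k -> (`|nth 0 vs u - c| <= k%:Z)%R /\ zodd (nth 0 vs u - c)%R = odd k,
          D x v k -> (`|nth 0 vs v - c| <= k%:Z)%R /\ zodd (nth 0 vs v - c)%R = odd k,
          W x u k -> zodd (nth 0 vs u - c)%R = (k != 0)
        & W x v k -> zodd (nth 0 vs v - c)%R = (k != 0)]].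
  move=> vx uv; have [|vs' [sz' HW' eqs]] := @Win_extend vs x _ HW; first by lia.
  have [a [b [Ha Hb ab]]] := (Win_step (vs := vs') ltac:(lia)).1 HW'.
  exists a, b; split=> [|c cab k' k'N]; first by rewrite -sz'.
  have Hc : Win (rcons vs' c) by case: cab => ->.
  have IHc u' : u' < N -> _ := fun u'N =>
    IH x (rcons vs' c) ltac:(lia) ltac:(by rewrite size_rcons sz') ltac:(lia) Hc u' k' u'N k'N.
  have nthx : nth 0%R (rcons vs' c) x = c by rewrite nth_eq_rcons sz' eqxx.
  have nthl i : i <= v -> nth 0%R (rcons vs' c) i = nth 0%R vs i.
    by move=> iv; rewrite nth_eq_rcons sz' ltn_eqF ?eqs ?sz //; lia.
  have := IHc u uN; have := IHc v (leq_trans vm mN).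
  by rewrite nthx !nthl // => -[? ?] [? ?].
split.
  case/(DE vN uN kN) => uv [[euv ->]|[x [k1 [k2 [[vx k1N k2N D1 D2] e]]]]].
    by have := edge euv uv; rewrite /zodd; lia.
  have [a [b [ab Hab]]] := split_at x vx uv.
  have [/(_ D1)[a1 p1] _ _ _] := Hab a (or_introl erefl) k1 k1N.
  have [_ /(_ D2)[a2 p2] _ _] := Hab a (or_introl erefl) k2 k2N.
  have [/(_ D1)[b1 q1] _ _ _] := Hab b (or_intror erefl) k1 k1N.
  have [_ /(_ D2)[b2 q2] _ _] := Hab b (or_intror erefl) k2 k2N.
  move: ab; set f := nth _ vs u in a1 b1 p1 q1 *.
  set g := nth _ vs v in a2 b2 p2 q2 *; move=> ab.
  have pfg : zodd (f - g) = odd k.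
    rewrite (_ : f - g = (f - a) + - (g - a))%R; last by ring.
    have : odd (k + 2 * ge2 x) = odd (k1 + k2) by rewrite e.
    by rewrite mul2n !oddD odd_double addbF => ->; rewrite zoddD zoddN p1 p2.
  split=> //; case: (ge2 x) e ab => /= e ab; last by clear -a1 a2 e; lia.
  have pab : zodd (a - b) = false.
    rewrite (_ : a - b = (f - b) + - (f - a))%R; last by ring.
    by rewrite zoddD zoddN p1 q1 addbb.
  have dab : (2 <= `|a - b|)%R by apply: zodd_dist; [exact: pab | exact: ab].
  by clear -a1 a2 b1 b2 e dab; lia.
case/(WE vN uN kN) => uv [[euv ->]|[x [k1 [k2 [[vx k1N k2N W1 W2] ->]]]]].
  by have := edge euv uv; rewrite /zodd; lia.
have [a [b [_ Hab]]] := split_at x vx uv.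
have [_ _ /(_ W1) e1 _] := Hab a (or_introl erefl) k1 k1N.
have [_ _ _ /(_ W2) e2] := Hab a (or_introl erefl) k2 k2N.
by rewrite -e1 -e2 !zoddD !zoddN; case: (zodd _) (zodd _) (zodd a) => [] [] [].
Qed.

(** A bound 0 leaves only one winning value for [x]; an odd closed walk would make the difference 0
    odd. *)
Lemma soundness : Win [::] ->
  (forall x u, u < x < m -> ge2 x -> ~~ D x u 0) /\
  (forall v b, v < m -> b < N -> b != 0 -> ~~ W v v b).
Proof.
move=> HW; split.
  move=> x u /andP[ux xm] g2; apply/negP => Dx.
  have [|vs [sz HWs _]] := @Win_extend [::] x _ HW; first exact: ltnW.
  have [a [b [Ha Hb /(_ _)]]] := (Win_step (vs := vs) ltac:(lia)).1 HWs.
  rewrite sz => /(_ g2); case.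
  have xN := leq_trans xm mN; have uN := ltn_trans ux xN.
  have N0 : 0 < N := leq_ltn_trans (leq0n _) xN.
  have H c : Win (rcons vs c) -> c = nth 0%R vs u.
    move=> Hc; have sc : size (rcons vs c) = x.+1 by rewrite size_rcons sz.
    have [/(_ Dx)[] + _ _] := sound_step sc xm Hc uN N0.
    by rewrite !nth_eq_rcons sz eqxx ltn_eqF //; lia.
  by rewrite (H a) // (H b).
move=> v b vm bN b0; apply/negP => Wv.
have [|vs [sz HWs _]] := @Win_extend [::] v.+1 _ HW; first exact: vm.
have [_ /(_ Wv)] := sound_step sz vm HWs (leq_trans vm mN) bN.
by rewrite subrr b0.
Qed.

(** * Completeness: a bipartition and a winning strategy *)

Section Completeness.
Hypothesis no_pin : forall x u, u < x < m -> ge2 x -> ~~ D x u 0.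
Hypothesis no_odd : forall v b, v < m -> b < N -> b != 0 -> ~~ W v v b.

(** Any single constraint between [i] and an earlier variable determines the colour of [i]. It
    agrees with every other one because eliminating [i] from the two gives a constraint that the
    earlier colours already satisfy. *)
Lemma coloring_upto i : i <= m -> exists c : nat -> bool,
  forall u v b, u <= v < i -> b < N -> W v u b -> c u (+) c v = (b != 0).
Proof.
elim: i => [|i IH] im; first by exists xpredT => u v b; rewrite ltn0 andbF.
have [c Hc] := IH (ltnW im).
have iN := leq_trans im mN.
pose c' X j := if j == i then X else c j.
suff [X HX] : exists X, forall u b, u < i -> b < N -> W i u b -> c u (+) X = (b != 0).
  exists (c' X) => u v b /andP[uv vi] bN; rewrite /c'.
  case: (eqVneq v i) => [-> Wi|vi'].
    case: (eqVneq u i) => [ui|ui]; last by apply: HX => //; lia.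
    by rewrite ui in Wi; rewrite addbb; apply/esym; apply: contraTF Wi => /(no_odd im bN).
  by rewrite ltn_eqF; [apply: Hc => //; lia | lia].
case: (pickP (fun ub : 'I_i * 'I_N => W i ub.1 ub.2)) => [[u0 b0] /= W0|noW]; last first.
  exists true => u b ui bN Wu; have := noW (Ordinal ui, Ordinal bN).
  by rewrite /= Wu.
exists (c u0 (+) (val b0 != 0)) => u b ui bN Wu.
have N1 : 1 < N by apply: leq_ltn_trans iN; apply: leq_ltn_trans ui.
(* The parity of the combined walk, as a number below [N]; this uses [1 < N]. *)
pose b1 : nat := (b != 0) (+) (val b0 != 0).
have b1E : (b1 != 0) = (b != 0) (+) (val b0 != 0) by rewrite /b1; case: (_ (+) _).
have b1N : b1 < N by rewrite /b1; case: (_ (+) _) => //; apply: ltnW.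
suff E : c u (+) c u0 = (b1 != 0) by rewrite addbA E b1E -addbA addbb addbF.
have u0i := ltn_ord u0; have b0N := ltn_ord b0.
have uN := ltn_trans ui iN; have u0N := ltn_trans u0i iN.
case: (leqP u u0) => [uu0|u0u].
  apply: Hc => //; first by rewrite uu0.
  apply/(WE u0N uN b1N); split=> //; right; exists i, b, (val b0).
  by rewrite u0i im bN b0N.
rewrite addbC; apply: Hc => //; first by rewrite (ltnW u0u).
apply/(WE uN u0N b1N); split; first exact: ltnW.
right; exists i, (val b0), b; split; first by rewrite ui im bN b0N.
by rewrite b1E addbC.
Qed.

Lemma coloring : exists c : nat -> bool, forall u v, ed u v -> c u (+) c v.
Proof.
have [c Hc] := coloring_upto (leqnn m); exists c.
suff H u v : u <= v -> ed u v -> c u (+) c v.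
  by move=> u v; case: (leqP u v) => [|/ltnW]; [exact: H|rewrite edC addbC; exact: H].
move=> uv euv; have [um vm] := ed_m euv; have N1 := ed_N euv.
rewrite (Hc u v 1) //; first by rewrite uv.
apply/WE => //; [exact: leq_trans mN|exact: leq_trans mN|by split=> //; left].
Qed.

Variable c : nat -> bool.
Hypothesis c_edge : forall u v, ed u v -> c u (+) c v.

(** Thus both ends of every interval of admissible values lie in the parity class of the variable to
    be played. *)
Lemma D_parity v u k : v < N -> u < N -> k < N -> D v u k -> odd k = c u (+) c v.
Proof.
have [n] := ubnP (m - v); elim: n v u k => // n IH v u k vn vN uN kN.
case/(DE vN uN kN) => uv [[/c_edge -> -> //]|[x [k1 [k2 [[vx k1N k2N D1 D2] e]]]]].
have xN : x < N by apply: leq_trans mN; case/andP: vx.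
have o1 := IH x u k1 ltac:(lia) xN uN k1N D1.
have o2 := IH x v k2 ltac:(lia) xN vN k2N D2.
have : odd (k + 2 * ge2 x) = odd (k1 + k2) by rewrite e.
by rewrite mul2n !oddD odd_double addbF o1 o2 => ->; rewrite -!addbA [c x (+) _]addbCA addbb addbF.
Qed.

Definition legal (vs : seq int) : Prop :=
  [/\ forall u, u < size vs -> zodd (nth 0%R vs u) = c u,
    forall u v k, u <= v < size vs -> k < N -> D v u k ->
      (`|nth 0 vs u - nth 0 vs v| <= k%:Z)%R
  & forall u v, u < size vs -> v < size vs ->
      (`|nth 0 vs u - nth 0 vs v| <= (size vs)%:Z)%R].

Lemma legal_rcons vs a : size vs < m -> legal vs ->
  zodd a = c (size vs) ->
  (forall u k, u < size vs -> k < N -> D (size vs) u k ->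
     (`|nth 0 vs u - a| <= k%:Z)%R) ->
  (forall u, u < size vs -> (`|nth 0 vs u - a| <= (size vs).+1%:Z)%R) ->
  legal (rcons vs a).
Proof.
move=> sm [Hp Hd Hr] pa da ra; split=> [u|u v k|u v]; rewrite size_rcons !nth_eq_rcons.
- by rewrite ltnS leq_eqVlt; case: (eqVneq u (size vs)) => [-> //|_] /= /Hp.
- case: (eqVneq v (size vs)) => [->|vs'].
    case: (eqVneq u (size vs)) => [->|us'] /andP[us _]; first by rewrite subrr.
    by apply: da; lia.
  move=> /andP[uv vs1] kN Dv; rewrite (_ : u == size vs = false); last by lia.
  by apply: Hd kN Dv; lia.
- case: (eqVneq v (size vs)) => [->|vs'].
    case: (eqVneq u (size vs)) => [->|us'] us _; first by rewrite subrr.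
    by apply: ra; lia.
  case: (eqVneq u (size vs)) => [->|us'] us vs1.
    by have := ra v ltac:(lia); lia.
  by have := Hr u v ltac:(lia) ltac:(lia); lia.
Qed.

Lemma seq_max (z : int) s :
  exists2 A : int, A \in z :: s & forall y, y \in z :: s -> (y <= A)%R.
Proof.
elim: s z => [|y s IH] z.
  by exists z; [exact: mem_head | move=> y; rewrite inE => /eqP->].
have [A As HA] := IH y.
case: (lerP A z) => Az.
  exists z; first exact: mem_head.
  by move=> t; rewrite inE => /predU1P[->|/HA tA] //; apply: le_trans Az.
exists A; first by rewrite inE As orbT.
by move=> t; rewrite inE => /predU1P[->|/HA //]; apply: ltW.
Qed.

(* The move A is the least value of the right parity that is at least lo - 1
   (so that the values played stay close together, which makes the dropped
   constraints of bound at least N harmless) and satisfies all the lower bounds;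
   the other move is A + 2. *)
Lemma legal_step vs : size vs < m -> legal vs -> exists a b,
  [/\ legal (rcons vs a), legal (rcons vs b) & ge2 (size vs) -> a <> b].
Proof.
move=> sm Hvs; have [Hp Hd Hr] := Hvs; set x := size vs in sm Hp Hd Hr *.
(* Before the first move there is no least value [lo], and no earlier value constrains the move. *)
case: (posnP x) => [x0|x0].
  have H a : zodd a = c x -> legal (rcons vs a).
    by move=> pa; apply: legal_rcons => // u; rewrite -/x x0.
  by exists (Posz (c x)), (Posz (c x) + 2)%R; split;
    [apply: H | apply: H |]; rewrite /zodd; case: (c x).
pose f u := nth 0%R vs u; have xN := leq_trans sm mN.
have [ulo ulox Hlo] : exists2 u, u < x & forall v, v < x -> (f u <= f v)%R.
  (* The minimum is obtained as the maximum of the opposites. *)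
  have [A] := seq_max (- f 0)%R [seq (- f u)%R | u <- iota 0 x].
  rewrite inE => HA Hmax.
  have [u ux Au] : exists2 u, u < x & A = (- f u)%R.
    case/predU1P: HA => [->|/mapP[u]]; first by exists 0.
    by rewrite mem_iota => ? ->; exists u.
  exists u => // v vx; rewrite -lerN2 -Au; apply: Hmax.
  by rewrite inE (map_f (fun u => (- f u)%R)) ?orbT // mem_iota.
set lo := f ulo in Hlo.
pose lo' := (if zodd lo == c x then lo else lo - 1)%R.
have plo' : zodd lo' = c x.
  rewrite /lo'; case: eqP => // ne; rewrite zoddD [zodd (- 1)](_ : _ = true) //.
  by case: (zodd lo) (c x) ne => [] [].
have lo'E : lo' = lo \/ lo' = (lo - 1)%R /\ zodd lo != c x.
  by rewrite /lo'; case: eqP => _; [left|right].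
have [A HA Amax] := seq_max lo' [seq (f u - k%:Z)%R | u <- iota 0 x,
  k <- [seq k <- iota 0 N | D x u k]].
have Alo' : (lo' <= A)%R by apply: Amax; rewrite mem_head.
have Amin u k : u < x -> k < N -> D x u k -> (f u - k%:Z <= A)%R.
  move=> ux kN Du; apply: Amax; rewrite inE; apply/orP; right.
  by apply/allpairsPdep; exists u, k; rewrite mem_iota mem_filter Du mem_iota.
have {}HA : A = lo' \/ exists u k, [/\ u < x, k < N, D x u k & A = (f u - k%:Z)%R].
  case/predU1P: HA => [|/allpairsPdep[u [k]]]; first by left.
  rewrite mem_iota mem_filter mem_iota => -[ux /andP[Du kN] ->].
  by right; exists u, k.
have parD u k : u < x -> k < N -> D x u k -> odd k = zodd (f u) (+) c x.
  by move=> ux kN /(D_parity xN (ltn_trans ux xN) kN) ->; rewrite Hp.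
have pA : zodd A = c x.
  case: HA => [-> //|[u [k [ux kN Du ->]]]].
  rewrite zoddD zoddN [zodd k%:Z]/zodd absz_nat (parD u) //.
  by rewrite addbA addbb.
have kpos u k : ge2 x -> u < x -> D x u k -> 0 < k.
  move=> g ux; case: k => // Du.
  by have := no_pin (x := x) (u := u); rewrite ux sm Du => /(_ isT g).
have Ahi u k : u < x -> k < N -> D x u k -> (A + (2 * ge2 x)%:Z <= f u + k%:Z)%R.
  move=> ux kN Du; have ku := kpos u k ^~ ux.
  have := parD u k ux kN Du; have := Hlo u ux; rewrite -/(f u) => lou.
  (* If [A] is [lo'], then [lo <= f u], and for two moves [k > 0] together with the parity of
     [f u + k] gives the missing distance. If [A] is the lower bound set by [v], the claim is the
     constraint between [u] and [v] obtained by eliminating [x]. *)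
  case: HA => [->|[v [l [vx lN Dv ->]]]] pk.
    move: pk ku; rewrite /zodd; case: (ge2 x) => /= pk ku; last first.
      by case: lo'E => [->|[-> _]]; lia.
    have {}ku := ku isT Du.
    by case: lo'E plo' => [->|[-> +]]; rewrite /zodd; case: (c x) pk => pk; lia.
  have lv := kpos v l ^~ vx.
  have le2 : 2 * ge2 x <= k + l.
    by case: (ge2 x) ku lv => //= /(_ isT Du) + /(_ isT Dv); lia.
  suff H : (`|f u - f v| <= (k + l - 2 * ge2 x)%:Z)%R by lia.
  case: (ltnP (k + l - 2 * ge2 x) N) => klN; last first.
    by have := Hr u v ux vx; rewrite -/(f u) -/(f v); lia.
  have uN := ltn_trans ux xN; have vN := ltn_trans vx xN.
  case: (leqP u v) => uv.
    apply: Hd => //; first by rewrite uv.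
    by apply/DE => //; split=> //; right; exists x, k, l; rewrite vx sm; split=> //; lia.
  rewrite distrC; apply: Hd => //; first by rewrite (ltnW uv).
  apply/DE => //; split; first exact: ltnW.
  by right; exists x, l, k; rewrite ux sm; split=> //; lia.
have rng u v : u < x -> v < x -> (`|f u - f v| <= x%:Z)%R by move=> ux vx; apply: Hr.
have H a : a = A \/ a = (A + (2 * ge2 x)%:Z)%R -> legal (rcons vs a).
  move=> Ha; apply: legal_rcons => //.
  - case: Ha => -> //; rewrite -pA /zodd; case: (ge2 x) => /=; lia.
  - move=> u k ux kN Du; have := Amin u k ux kN Du; have := Ahi u k ux kN Du.
    by rewrite -/(f u); case: Ha => ->; lia.
  (* Every move is at least [lo - 1]. It is at most [lo + 2], which is enough as [x > 0], or it is
     at most [f v + 1], since [l > 0] whenever 2 is added. *)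
  - move=> u ux; rewrite -/(f u) -/x.
    have lou := Hlo u ux; have := rng u ulo ux ulox; rewrite -/lo => rlo.
    case: HA => [AE|[v [l [vx lN Dv AE]]]].
      by case: (ge2 x) Ha => /= Ha; case: lo'E => [|[]] => lE; case: Ha; lia.
    have := rng u v ux vx; have lv := kpos v l ^~ vx.
    by case: (ge2 x) Ha lv => /= Ha => [/(_ isT Dv)|_]; case: lo'E => [|[]] => lE;
      case: Ha; lia.
exists A, (A + (2 * ge2 x)%:Z)%R; split; [by apply: H; left|by apply: H; right|].
by move->; lia.
Qed.

Lemma legal_Win vs : size vs <= m -> legal vs -> Win vs.
Proof.
have [n] := ubnP (m - size vs); elim: n vs => // n IH vs vn; rewrite leq_eqVlt.
case/predU1P=> [sm|sm] Hvs; last first.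
  have [a [b [Ha Hb ab]]] := legal_step sm Hvs.
  by apply/Win_step => //; exists a, b; split=> //; apply: IH => //; rewrite size_rcons //; lia.
apply/Win_end => //; apply/PE => //.
suff H u v : u <= v -> ed u v -> (`|nth 0 vs u - nth 0 vs v| = 1)%R.
  move=> u v; case: (leqP u v) => [|/ltnW]; first exact: H.
  by rewrite edC distrC; apply: H.
move=> uv euv; have [um vm] := ed_m euv; have N1 := ed_N euv.
have [Hp Hd _] := Hvs; rewrite sm in Hp Hd.
have : (`|nth 0 vs u - nth 0 vs v| <= 1%:Z)%R.
  apply: Hd => //; first by rewrite uv.
  by apply/DE => //; [exact: leq_trans mN|exact: leq_trans mN|split=> //; left].
(* A distance that is odd and at most 1 equals 1. *)
have := c_edge euv; rewrite -!Hp // /zodd; lia.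
Qed.

End Completeness.

Lemma game : Win [::] <->
  (forall x u, u < x < m -> ge2 x -> ~~ D x u 0) /\
  (forall v b, v < m -> b < N -> b != 0 -> ~~ W v v b).
Proof.
split; first exact: soundness.
case=> no_pin no_odd; have [c Hc] := coloring no_odd.
by apply: (legal_Win no_pin Hc) => //; split=> // u v k /andP[].
Qed.

End Game.

(** * Reading the encoding *)

Lemma nat_bits_bin n : nat_bits (nat_of_bin n) =
  if n is Npos p then pos_bits p else [::].
Proof. by rewrite /nat_bits nat_of_binK. Qed.

Lemma nat_bits_cons (b : bool) bs v : nat_bits v = b :: bs <->
  exists v', [/\ nat_bits v' = bs, v = b + v'.*2 & v != 0].
Proof.
have cons (c : bool) (p : positive) : nat_bits (c + (nat_of_pos p).*2) = c :: pos_bits p.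
  have := nat_bits_bin (Npos (if c then xI p else xO p)).
  by case: c => /=; rewrite NatTrec.doubleE.
split.
  have := nat_bits_bin (bin_of_nat v); rewrite bin_of_natK => ->.
  have := bin_of_natK v; case: (bin_of_nat v) => //= p <-.
  case: p => [p|p|] /= [<- <-].
  - exists (nat_of_pos p); rewrite NatTrec.doubleE; split=> //.
    exact: (nat_bits_bin (Npos p)).
  - exists (nat_of_pos p); rewrite NatTrec.doubleE; split=> //.
      exact: (nat_bits_bin (Npos p)).
    by have := bin_of_natK (nat_of_pos p); case: (nat_of_pos p) (cons false p) => //.
  - by exists 0.
case=> v' [<- -> nz].
rewrite -(bin_of_natK v') in nz *; case: (bin_of_nat v') nz => [|p] nz.
  by case: b nz.
by rewrite (nat_bits_bin (Npos p)) cons.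
Qed.

Fixpoint lead (s : seq token) : seq bool :=
  if s is TokBit b :: s' then b :: lead s' else [::].

Fixpoint rest (s : seq token) : seq token :=
  if s is TokBit _ :: s' then rest s' else s.

Definition starts_atom (s : seq token) : bool :=
  match s with [::] | TokE :: _ => true | _ => false end.

Definition second_lead (s : seq token) (v : nat) : bool :=
  if rest s is TokComma :: s' then lead s' == nat_bits v else false.

Definition is_quant (a : token) : bool :=
  match a with TokEx1 | TokEx2 => true | _ => false end.
Definition is_ex2 (a : token) : bool := if a is TokEx2 then true else false.
Definition is_E (a : token) : bool := if a is TokE then true else false.
Definition is_comma (a : token) : bool := if a is TokComma then true else false.
Definition is_bit (a : token) : bool := if a is TokBit _ then true else false.
Definition is_one (a : token) : bool := if a is TokBit true then true else false.

(** Encodings are recognised by a condition on each letter [a] and the suffix [s] after it, which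
    suits definitions by descent on positions. Bits need none: the letters before a numeral
    determine what may follow. [V] tells which numbers are variables. *)
Definition letter_ok (V : nat -> bool) (a : token) (s : seq token) : Prop :=
  match a with
  | TokEx1 | TokEx2 => if s is b :: _ then is_quant b || is_E b else true
  | TokE => exists u v, [/\ V u, V v, lead s = nat_bits u & second_lead s v]
  | TokComma => starts_atom (rest s)
  | TokBit _ => True
  end.

Definition all_suffixes (P : token -> seq token -> Prop) (s : seq token) : Prop :=
  forall i a, onth s i = Some a -> P a (drop i.+1 s).

Lemma all_suffixes_cons P a s :
  all_suffixes P (a :: s) <-> P a s /\ all_suffixes P s.
Proof.
split=> [H|[Pa H]].
  by split=> [|i b]; [have := H 0 a erefl; rewrite /= drop0 | apply: (H i.+1)].
by case=> [|i] b /=; [case=> <-; rewrite drop0 | apply: H].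
Qed.

Lemma all_suffixes_bits V bs s :
  all_suffixes (letter_ok V) (map TokBit bs ++ s) <-> all_suffixes (letter_ok V) s.
Proof.
elim: bs => //= b bs IH; rewrite all_suffixes_cons /= IH; tauto.
Qed.

Definition atom_code (e : nat * nat) : seq token :=
  TokE :: encode_var e.1 ++ TokComma :: encode_var e.2.

Definition atoms_code (l : seq (nat * nat)) : seq token :=
  flatten (map atom_code l).

Lemma starts_atoms_code l : starts_atom (atoms_code l).
Proof. by case: l. Qed.

Lemma rest_size s : size (rest s) <= size s.
Proof. by elim: s => //= -[] //= b s /leqW. Qed.

Lemma lead_bits bs s : rest s = s -> lead (map TokBit bs ++ s) = bs.
Proof.
move=> rs; elim: bs => [|b bs /= ->] //=.
by case: s rs => // -[] //= b s e; have := rest_size s; rewrite e /= ltnn.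
Qed.

Lemma rest_bits bs s : rest (map TokBit bs ++ s) = rest s.
Proof. by elim: bs. Qed.

Lemma lead_rest s : s = map TokBit (lead s) ++ rest s.
Proof. by elim: s => //= -[] //= b s <-. Qed.

Lemma starts_atom_rest s : starts_atom s -> rest s = s.
Proof. by case: s => // -[]. Qed.

Lemma atom_code_leads u v s : starts_atom s ->
  lead (encode_var u ++ TokComma :: encode_var v ++ s) = nat_bits u /\
  forall v', second_lead (encode_var u ++ TokComma :: encode_var v ++ s) v' = (v == v').
Proof.
move=> /starts_atom_rest rs; rewrite /second_lead /encode_var lead_bits // rest_bits /=.
by split=> // v'; rewrite lead_bits // (inj_eq nat_bits_inj).
Qed.

Lemma all_suffixes_code V qs l : all (fun e => V e.1 && V e.2) l ->
  all_suffixes (letter_ok V) (map encode_quantifier qs ++ atoms_code l).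
Proof.
move=> Hl; have {Hl} : all_suffixes (letter_ok V) (atoms_code l).
  elim: l Hl => [|[u v] l IH] /=; first by move=> _ [].
  case/andP=> /andP[Vu Vv] /IH H; rewrite /atoms_code /= -catA /= -/(atoms_code l).
  have [e1 e2] := atom_code_leads u v (starts_atoms_code l).
  apply/all_suffixes_cons; split; first by exists u, v; rewrite e2 eqxx.
  apply/all_suffixes_bits/all_suffixes_cons; split; last exact/all_suffixes_bits.
  by rewrite /= /encode_var rest_bits starts_atom_rest starts_atoms_code.
elim: qs => //= q qs IH H; apply/all_suffixes_cons; split; last exact: IH.
by case: q; case: qs {IH} => [|[] qs] //=; case: l {H}.
Qed.

Lemma split_quantifiers V w : all_suffixes (letter_ok V) w ->
  (if w is a :: _ then is_quant a || is_E a else true) ->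
  exists qs s, [/\ w = map encode_quantifier qs ++ s, starts_atom s
    & all_suffixes (letter_ok V) s].
Proof.
elim: w => [|a w IH]; first by exists [::], [::].
move/all_suffixes_cons=> [Ha Hw] qa.
case: (boolP (is_quant a)) => [q|nq]; last first.
  exists [::], (a :: w); split=> //; last exact/all_suffixes_cons.
  by case: a nq qa {Ha}.
have [|qs [s [-> ss Hs]]] := IH Hw; first by case: a q Ha {qa} => // _; case: (w).
case: a q {Ha qa} => // _; [exists (ExistsGe1 :: qs), s|exists (ExistsGe2 :: qs), s]; by [].
Qed.

Lemma split_atoms V s : all_suffixes (letter_ok V) s -> starts_atom s ->
  exists2 l, s = atoms_code l & all (fun e => V e.1 && V e.2) l.
Proof.
have [n] := ubnP (size s); elim: n s => // n IH s sn.
case: s sn => [|[] s] //=; first by exists [::].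
rewrite ltnS => sn /all_suffixes_cons[[u [v [Vu Vv lu lv]]] Hs] _.
have es := lead_rest s; rewrite es lu in Hs; move/all_suffixes_bits: Hs.
move: lv es (rest_size s); rewrite /second_lead lu.
case: (rest s) => [|[] s'] //= /eqP lv es ss' /all_suffixes_cons[/= sa].
have es' := lead_rest s'; rewrite es' lv => /all_suffixes_bits Hs.
have [||l El Hl] := IH (rest s') _ Hs.
- by have := rest_size s'; lia.
- exact: sa.
exists ((u, v) :: l); last by rewrite /= Vu Vv.
by rewrite /atoms_code /= -catA -/(atoms_code l) -El es {1}es' lv.
Qed.

(** The prefix comes first, with one letter per quantifier, so the positions of quantifier letters
    are exactly the variables. *)
Lemma code_letter (f : token -> bool) qs l i :
  (forall a, f a -> is_quant a) ->
  (if onth (map encode_quantifier qs ++ atoms_code l) i is Some a then f a else false)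
  = (i < size qs) && f (encode_quantifier (nth ExistsGe1 qs i)).
Proof.
move=> fq; elim: qs i => [|q qs IH] [|i] //=; rewrite ?ltnS //.
- by case: l => [|e l] //=; apply/negbTE/negP => /fq.
- set s := atoms_code l; have : all (fun a => ~~ is_quant a) s.
    rewrite /s; elim: (l) => //= e l' IHl; rewrite /atoms_code /= !all_cat /= IHl.
    by rewrite /encode_var !all_map andbT; apply/andP; split; apply/allP.
  rewrite -/(onth s i.+1); move: i.+1; elim: s => [|a s IHs] [|j] //= /andP[na Hs]; last exact: IHs.
  by apply: contraNF na; apply: fq.
Qed.

Definition has_atom (s : seq token) (u v : nat) : Prop :=
  exists2 i, onth s i = Some TokE &
    lead (drop i.+1 s) = nat_bits u /\ second_lead (drop i.+1 s) v.

Lemma has_atom_cons a s u v : has_atom (a :: s) u v <->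
  (a = TokE /\ lead s = nat_bits u /\ second_lead s v) \/ has_atom s u v.
Proof.
split=> [[[|i] /=]|[[-> H]|[i]]].
- by case=> ->; rewrite drop0; left.
- by move=> ia H; right; exists i.
- by exists 0 => //=; rewrite drop0.
- by exists i.+1.
Qed.

Lemma has_atom_skip p s u v : all (fun a => ~~ is_E a) p ->
  has_atom (p ++ s) u v <-> has_atom s u v.
Proof.
elim: p => //= a p IH /andP[na /IH {}IH]; rewrite has_atom_cons IH.
by split=> [[[ea]|]|] //; [rewrite ea in na | right].
Qed.

Lemma has_atom_code qs l u v :
  has_atom (map encode_quantifier qs ++ atoms_code l) u v <-> (u, v) \in l.
Proof.
have bitsE n : all (fun a => ~~ is_E a) (encode_var n).
  by rewrite all_map; apply/allP.
rewrite has_atom_skip; last by rewrite all_map; elim: (qs) => //= -[].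
elim: l => [|[u' v'] l IH]; first by split=> // -[[|i]].
rewrite /atoms_code /= -catA /= -/(atoms_code l) has_atom_cons.
have [-> e2] := atom_code_leads u' v' (starts_atoms_code l).
rewrite e2 has_atom_skip // has_atom_cons has_atom_skip // IH inE xpair_eqE.
split.
  case=> [[_ [/nat_bits_inj -> /eqP->]]|[[]|->]] //; last by rewrite orbT.
  by rewrite !eqxx.
by case/orP=> [/andP[/eqP-> /eqP->]|]; [left|right; right].
Qed.

Lemma encodeE (phi : sentence) : encode phi =
  map encode_quantifier (qprefix phi) ++
  atoms_code (map (fun e => (val e.1, val e.2)) (atoms phi)).
Proof. by rewrite /encode /atoms_code -map_comp. Qed.

Definition syntax_ok (w : seq token) : Prop :=
  (if w is a :: _ then is_quant a else true) /\
  all_suffixes (letter_ok (letter w is_quant)) w.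

Lemma is_quant_encode q : is_quant (encode_quantifier q).
Proof. by case: q. Qed.

Lemma letter_encode (phi : sentence) (f : token -> bool) i : (forall a, f a -> is_quant a) ->
  letter (encode phi) f i =
    (i < nvars phi) && f (encode_quantifier (nth ExistsGe1 (qprefix phi) i)).
Proof. by move=> fq; rewrite /letter encodeE code_letter // size_tuple. Qed.

Lemma syntax_okP w : syntax_ok w <-> exists phi, encode phi = w.
Proof.
split=> [[hd Hw]|[phi <-]]; last first.
  split; last first.
    rewrite {2}encodeE; apply: all_suffixes_code; apply/allP => _ /mapP[[u v] _ ->] /=.
    by rewrite !letter_encode // !is_quant_encode !ltn_ord.
  (* Without variables there are no atoms, so a nonempty encoding starts with a quantifier. *)
  rewrite encodeE; case: phi => [[|m] q a] /=.
    by case: a => [|[[]]] //; rewrite tuple0.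
  by case: q => -[|q qs] //= _; rewrite is_quant_encode.
have [|qs [s [ew ss Hs]]] := split_quantifiers Hw.
  by case: (w) hd => //= a _ ->.
have [l es Hl] := split_atoms Hs ss; rewrite es in ew.
have qV i : letter w is_quant i = (i < size qs).
  by rewrite /letter ew code_letter // is_quant_encode andbT.
have [a ea] : exists a : seq ('I_(size qs) * 'I_(size qs)),
    map (fun e => (val e.1, val e.2)) a = l.
  elim: l Hl {es ew} => [|[u v] l IH] /=; first by exists [::].
  rewrite !qV => /andP[/andP[um vm] /IH[a <-]].
  by exists ((Ordinal um, Ordinal vm) :: a).
by exists (Sentence (in_tuple qs) a); rewrite encodeE /= ea ew.
Qed.

Lemma has_iotaP n (p : pred nat) :
  reflect (exists2 j, j < n & p j) (has p (iota 0 n)).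
Proof.
apply: (iffP hasP) => -[j jn pj]; exists j => //; move: jn; by rewrite mem_iota.
Qed.

Lemma has_next n i (p : pred nat) :
  has (fun j => (i + 0 + 1 == j + 0) && p j) (iota 0 n) = (i.+1 < n) && p i.+1.
Proof.
apply/has_iotaP/andP => [[j jn /andP[/eqP e pj]]|[iN pi]].
  have -> : i.+1 = j by lia.
  by [].
by exists i.+1; rewrite // !addn0 addn1 eqxx.
Qed.

Lemma letter_size (w : seq token) f i : letter w f i -> i < size w.
Proof.
by rewrite /letter -onthTE; case: (onth w i).
Qed.

(** * Formulas that read the input *)

Definition Disj (phi psi : fml token) : fml token :=
  Neg (Conj (Neg phi) (Neg psi)).

Definition eq0 (x : nat) : fml token := Sum _ [:: x] 0 [::].

(* The free variables 0, 1, 2 are the arguments of the relation being defined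
   and 3, 4, ... are bound by Ex from the outside in. The relations are
   0: v is the value of the numeral that follows position i;
   1: v is the value of the numeral after the comma that comes next after i;
   2: the numeral that follows i ends at an atom or at the end of the word;
   3: u and v are adjacent; 4 and 5: the relations D and W of the game. *)
Definition num_fml : fml token :=
  Disj
    (Ex (Conj (Sum _ [:: 0] 1 [:: 3]) (Conj (Letter is_bit 3)
      (Ex (Conj (Rel _ 0 3 4 4) (Conj (Neg (eq0 1))
        (Disj (Conj (Letter is_one 3) (Sum _ [:: 4; 4] 1 [:: 1]))
          (Conj (Neg (Letter is_one 3)) (Sum _ [:: 4; 4] 0 [:: 1])))))))))
    (Conj (Neg (Ex (Conj (Sum _ [:: 0] 1 [:: 3]) (Letter is_bit 3)))) (eq0 1)).

Definition second_fml : fml token :=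
  Ex (Conj (Sum _ [:: 0] 1 [:: 3])
    (Disj (Conj (Letter is_comma 3) (Rel _ 0 3 1 1))
          (Conj (Letter is_bit 3) (Rel _ 1 3 1 1)))).

Definition starts_fml : fml token :=
  Neg (Ex (Conj (Sum _ [:: 0] 1 [:: 3])
    (Neg (Disj (Letter is_E 3) (Conj (Letter is_bit 3) (Rel _ 2 3 3 3)))))).

Definition edge_fml : fml token :=
  Ex (Conj (Letter is_E 3)
    (Disj (Conj (Rel _ 0 3 0 0) (Rel _ 1 3 1 1))
          (Conj (Rel _ 0 3 1 1) (Rel _ 1 3 0 0)))).

Section Word.
Variable w : seq token.
Notation N := (size w).

Lemma drop_letter i a : onth w i = Some a -> drop i w = a :: drop i.+1 w.
Proof. by elim: w i => [|b s IH] [|i] //=; [case=> -> | apply: IH]; rewrite drop0. Qed.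

Lemma drop_next i : drop i.+1 w =
  if onth w i.+1 is Some a then a :: drop i.+2 w else [::].
Proof.
case e: (onth w i.+1) => [a|]; first exact: drop_letter.
by apply: drop_oversize; rewrite leqNgt -onthTE e.
Qed.

Lemma num_satE (rho : rels) i v z : sat w rho [:: i; v; z] num_fml =
  if letter w is_bit i.+1 then
    has (fun v' => [&& rho 0 i.+1 v' v', v != 0 & v == letter w is_one i.+1 + v'.*2])
      (iota 0 N)
  else v == 0.
Proof.
rewrite /= !has_next; case bit: (letter w is_bit i.+1); rewrite ?andbF /=; last first.
  by rewrite !addn0 negbK.
rewrite (letter_size bit) /= andbT negbK; apply: eq_has => v'.
rewrite !addn0; congr (_ && (_ && _)).
by case: (letter w is_one i.+1) => /=; rewrite ?andbF ?orbF ?andbT /=; apply/idP/idP; lia.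
Qed.

Lemma second_satE (rho : rels) i v z : sat w rho [:: i; v; z] second_fml =
  letter w is_comma i.+1 && rho 0 i.+1 v v || letter w is_bit i.+1 && rho 1 i.+1 v v.
Proof.
rewrite /= has_next negb_and !negbK; case: ltnP => // iN.
by apply/esym/norP; split; apply/negP => /andP[/letter_size]; lia.
Qed.

Lemma starts_satE (rho : rels) i y z : sat w rho [:: i; y; z] starts_fml =
  [|| N <= i.+1, letter w is_E i.+1 | letter w is_bit i.+1 && rho 2 i.+1 i.+1 i.+1].
Proof. by rewrite /= has_next negb_and !negbK -leqNgt negb_and !negbK. Qed.

(** The induction principle that matches [guarded]. *)
Lemma down_ind (Q : nat -> Prop) :
  (forall i, i < N -> (forall j, i < j < N -> Q j) -> Q i) -> forall i, i < N -> Q i.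
Proof.
move=> H i; have [n] := ubnP (N - i); elim: n i => // n IH i ni iN.
by apply: H => // j jN; apply: IH; lia.
Qed.

(** A numeral of value at least [N] is matched by no position, as it should be: variables are
    positions. *)
Lemma num_spec (rho : rels) :
  (forall i v z, i < N -> v < N -> z < N -> rho 0 i v z = sat w rho [:: i; v; z] num_fml) ->
  forall i v z, i < N -> v < N -> z < N ->
    rho 0 i v z = (lead (drop i.+1 w) == nat_bits v).
Proof.
move=> eq i v z iN; move: i iN v z; apply: down_ind => i iN IH v z vN zN.
rewrite eq // num_satE drop_next /letter.
have nil_bits : ([::] == nat_bits v) = (v == 0).
  by rewrite eq_sym -[[::]]/(nat_bits 0) (inj_eq nat_bits_inj).
case ew: (onth w i.+1) => [a|] //=.
have i1N : i.+1 < N by rewrite -onthTE ew.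
case bit: (is_bit a); last by case: a ew bit.
case: a bit ew => // b _ ew /=.
apply/has_iotaP/eqP => [[v' v'N /and3P[r nz /eqP e]]|/esym/nat_bits_cons[v' [e1 e2 nz]]].
  apply/esym/nat_bits_cons; exists v'; split=> //; last by rewrite e; case: (b).
  by apply/esym/eqP; rewrite -(IH i.+1 _ v' v') // ltnSn.
(* The value of the remaining bits is at most [v], hence in the range of [Ex]. *)
have v'N : v' < N by lia.
exists v' => //; rewrite IH ?ltnSn // e1 eqxx nz /= e2.
by case: (b).
Qed.

Lemma second_spec (rho : rels) :
  (forall i v z, i < N -> v < N -> z < N ->
    rho 0 i v z = (lead (drop i.+1 w) == nat_bits v)) ->
  (forall i v z, i < N -> v < N -> z < N ->
    rho 1 i v z = sat w rho [:: i; v; z] second_fml) ->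
  forall i v z, i < N -> v < N -> z < N ->
    rho 1 i v z = second_lead (drop i.+1 w) v.
Proof.
move=> num eq i v z iN; move: i iN v z; apply: down_ind => i iN IH v z vN zN.
rewrite eq // second_satE drop_next /letter.
case ew: (onth w i.+1) => [a|] //=.
have i1N : i.+1 < N by rewrite -onthTE ew.
case: a ew => //= [_|b _]; first by rewrite orbF num.
by rewrite IH // ltnSn.
Qed.

Lemma starts_spec (rho : rels) :
  (forall i v z, i < N -> v < N -> z < N ->
    rho 2 i v z = sat w rho [:: i; v; z] starts_fml) ->
  forall i v z, i < N -> v < N -> z < N ->
    rho 2 i v z = starts_atom (rest (drop i.+1 w)).
Proof.
move=> eq i v z iN; move: i iN v z; apply: down_ind => i iN IH v z vN zN.
rewrite eq // starts_satE drop_next /letter.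
case ew: (onth w i.+1) => [a|] //=; last first.
  by rewrite leqNgt -onthTE ew.
have i1N : i.+1 < N by rewrite -onthTE ew.
rewrite leqNgt i1N /=; case: a ew => //= b _.
by rewrite IH // ltnSn.
Qed.

Lemma num_guarded : guarded 5 w 0 num_fml.
Proof.
move=> i v z rho rho' iN vN zN _ H; rewrite !num_satE; case: ifP => // /letter_size i1N.
by apply: eq_in_has => v'; rewrite mem_iota => v'N; rewrite H.
Qed.

Lemma second_guarded : guarded 5 w 1 second_fml.
Proof.
move=> i v z rho rho' iN vN zN H0 H; rewrite !second_satE.
by congr orb; apply: andb_id2l => /letter_size i1N; [apply: H0 | apply: H].
Qed.

Lemma starts_guarded : guarded 5 w 2 starts_fml.
Proof.
move=> i v z rho rho' iN vN zN H0 H; rewrite !starts_satE.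
by congr [|| _, _ | _]; apply: andb_id2l => /letter_size i1N; apply: H.
Qed.

Lemma edge_guarded : guarded 5 w 3 edge_fml.
Proof.
move=> u v z rho rho' uN vN zN H _ /=; apply: eq_in_has => i; rewrite mem_iota => iN.
by rewrite !H.
Qed.

Lemma edge_spec (rho : rels) :
  (forall i v z, i < N -> v < N -> z < N ->
    rho 0 i v z = (lead (drop i.+1 w) == nat_bits v)) ->
  (forall i v z, i < N -> v < N -> z < N ->
    rho 1 i v z = second_lead (drop i.+1 w) v) ->
  forall u v z, u < N -> v < N ->
    sat w rho [:: u; v; z] edge_fml <-> has_atom w u v \/ has_atom w v u.
Proof.
move=> num snd u v z uN vN /=.
have Eat i : i < N -> letter w is_E i <-> onth w i = Some TokE.
  by move=> iN; rewrite /letter; case: (onth w i) => [[]|].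
split.
  case/has_iotaP=> i iN /andP[/(Eat i iN) Ei].
  rewrite !num // !snd // negb_and !negbK => /orP[]/andP[/eqP e1 e2]; [left|right];
    by exists i.
by case=> -[i ei [/eqP e1 e2]]; have iN : i < N by [rewrite -onthTE ei];
  apply/has_iotaP; exists i; rewrite // (Eat i iN).2 // negb_and !negbK;
  rewrite !num // !snd // e1 e2 ?orbT.
Qed.

End Word.

(** * Formulas for the game and for acceptance *)

Definition leq_fml (d x y : nat) : fml token := Ex (Sum _ [:: x; d] 0 [:: y]).
(** As variables are levels, [leq_fml] and [ltn_fml] take as [d] the level of the variable they
    bind, which is the number of variables in scope. *)
Definition ltn_fml (d x y : nat) : fml token := Ex (Sum _ [:: x; d] 1 [:: y]).
Definition Iff (phi psi : fml token) : fml token :=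
  Disj (Conj phi psi) (Conj (Neg phi) (Neg psi)).

(** Levels 0, 1, 2 are v, u, k of [dist_rule], and 3, 4, 5 are x, k1, k2. *)
Definition dist_fml : fml token :=
  Conj (leq_fml 3 1 0) (Disj
    (Conj (Rel _ 3 1 0 0) (Sum _ [::] 1 [:: 2]))
    (Ex (Conj (ltn_fml 4 0 3) (Conj (Letter is_quant 3)
      (Ex (Ex (Conj (Conj (Rel _ 4 3 1 4) (Rel _ 4 3 0 5))
        (Disj (Conj (Letter is_ex2 3) (Sum _ [:: 2] 2 [:: 4; 5]))
          (Conj (Neg (Letter is_ex2 3)) (Sum _ [:: 2] 0 [:: 4; 5])))))))))).

(** The nested [Iff] is the exclusive or of [parity_rule], written for the negated bits: b is 0 iff
    b1 and b2 are both zero or both nonzero. *)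
Definition parity_fml : fml token :=
  Conj (leq_fml 3 1 0) (Disj
    (Conj (Rel _ 3 1 0 0) (Neg (eq0 2)))
    (Ex (Conj (ltn_fml 4 0 3) (Conj (Letter is_quant 3)
      (Ex (Ex (Conj (Conj (Rel _ 5 3 1 4) (Rel _ 5 3 0 5))
        (Iff (eq0 2) (Iff (eq0 4) (eq0 5)))))))))).

(** One disjunct for each way in which a position can violate [syntax_ok]. The empty word has no
    position and is accepted as the encoding of the sentence without variables. *)
Definition syntax_error_fml : fml token :=
  Ex (Disj (Conj (eq0 0) (Neg (Letter is_quant 0)))
    (Disj (Conj (Letter is_quant 0) (Ex (Conj (Sum _ [:: 0] 1 [:: 1])
        (Neg (Letter (fun a => is_quant a || is_E a) 1)))))
    (Disj (Conj (Letter is_E 0) (Neg (Ex (Ex (Conj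
        (Conj (Rel _ 0 0 1 1) (Rel _ 1 0 2 2))
        (Conj (Letter is_quant 1) (Letter is_quant 2)))))))
      (Conj (Letter is_comma 0) (Neg (Rel _ 2 0 0 0)))))).

Definition pin_fml : fml token :=
  Ex (Ex (Ex (Conj (Conj (Letter is_ex2 0) (ltn_fml 3 1 0))
    (Conj (eq0 2) (Rel _ 4 0 1 2))))).

Definition odd_fml : fml token :=
  Ex (Ex (Conj (Letter is_quant 0) (Conj (Neg (eq0 1)) (Rel _ 5 0 0 1)))).

Definition final_fml : fml token :=
  Conj (Neg syntax_error_fml) (Conj (Neg pin_fml) (Neg odd_fml)).

Section Word.
Variable w : seq token.
Notation N := (size w).

Lemma has_leq n x y a : y < n ->
  has (fun t => x + (t + 0) + a == y + 0) (iota 0 n) = (x + a <= y).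
Proof.
move=> yn; apply/has_iotaP/idP => [[t _ /eqP]|xy]; first lia.
by exists (y - (x + a)); lia.
Qed.

(** The elimination rule of the game with its data read off the word: a quantifier letter at [x]
    expresses that [x] is a variable. *)
Definition dist_rule (ed : nat -> nat -> bool) (D : nat -> nat -> nat -> bool) v u k :=
  u <= v /\ ((ed u v /\ k = 1) \/ exists x k1 k2,
    [/\ v < x, letter w is_quant x, k1 < N, k2 < N & D x u k1 /\ D x v k2] /\
    k + 2 * letter w is_ex2 x = k1 + k2).

Lemma dist_satP (rho : rels) v u k : v < N -> u < N -> k < N ->
  sat w rho [:: v; u; k] dist_fml <->
  dist_rule (fun u v => rho 3 u v v) (rho 4) v u k.
Proof.
move=> vN uN kN; rewrite /= has_leq // addn0 negb_and !negbK /dist_rule.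
split.
  case/andP=> uv; case/orP=> [/andP[e]|].
    by rewrite addn0 add0n => /eqP<-; split=> //; left.
  case/has_iotaP=> x xN; rewrite has_leq // => /and3P[vx qx].
  case/has_iotaP=> k1 k1N /has_iotaP[k2 k2N /andP[/andP[D1 D2]]].
  rewrite negb_and !negbK => e; split=> //; right; exists x, k1, k2.
  split; first by split=> //; lia.
  by case/orP: e => /andP[]; case: (letter w is_ex2 x) => //=; lia.
case=> -> [[-> ->]|[x [k1 [k2 [[vx qx k1N k2N [D1 D2]] e]]]]] //=.
apply/orP; right; have xN := letter_size qx.
apply/has_iotaP; exists x => //; rewrite has_leq // addn1 vx qx /=.
apply/has_iotaP; exists k1 => //; apply/has_iotaP; exists k2 => //.
rewrite D1 D2 /= negb_and !negbK.
by case: (letter w is_ex2 x) e => /= e; rewrite ?orbF; lia.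
Qed.

Definition parity_rule (ed : nat -> nat -> bool) (W : nat -> nat -> nat -> bool) v u b :=
  u <= v /\ ((ed u v /\ b != 0) \/ exists x b1 b2,
    [/\ v < x, letter w is_quant x, b1 < N, b2 < N & W x u b1 /\ W x v b2] /\
    (b != 0) = (b1 != 0) (+) (b2 != 0)).

Lemma parity_satP (rho : rels) v u b : v < N -> u < N -> b < N ->
  sat w rho [:: v; u; b] parity_fml <->
  parity_rule (fun u v => rho 3 u v v) (rho 5) v u b.
Proof.
move=> vN uN bN; rewrite /= has_leq // !addn0 negb_and !negbK /parity_rule.
have xorE b1 b2 : ~~ (~~ ((b == 0) && ~~ (~~ ((b1 == 0) && (b2 == 0)) &&
      ~~ (~~ (b1 == 0) && ~~ (b2 == 0)))) &&
    ~~ (~~ (b == 0) && ~~ ~~ (~~ ((b1 == 0) && (b2 == 0)) &&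
      ~~ (~~ (b1 == 0) && ~~ (b2 == 0)))))
    = ((b != 0) == (b1 != 0) (+) (b2 != 0)).
  by case: (b == 0); case: (b1 == 0); case: (b2 == 0).
split.
  case/andP=> uv; case/orP=> [/andP[e b0]|]; first by split=> //; left.
  case/has_iotaP=> x xN; rewrite has_leq // => /and3P[vx qx].
  case/has_iotaP=> b1 b1N /has_iotaP[b2 b2N /andP[/andP[W1 W2]]].
  rewrite !addn0 xorE => /eqP e; split=> //; right; exists x, b1, b2.
  by split=> //; split=> //; lia.
case=> -> [[-> ->]|[x [b1 [b2 [[vx qx b1N b2N [W1 W2]] e]]]]] //=.
apply/orP; right; have xN := letter_size qx.
apply/has_iotaP; exists x => //; rewrite has_leq // addn1 vx qx /=.
apply/has_iotaP; exists b1 => //; apply/has_iotaP; exists b2 => //.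
by rewrite W1 W2 /= !addn0 xorE e.
Qed.

Lemma dist_guarded : guarded 5 w 4 dist_fml.
Proof.
suff H v u k (rho rho' : rels) : v < N -> u < N -> k < N ->
    (forall a b, a < N -> b < N -> rho 3 a b b = rho' 3 a b b) ->
    (forall a b c, v < a -> a < N -> b < N -> c < N -> rho 4 a b c = rho' 4 a b c) ->
    sat w rho [:: v; u; k] dist_fml -> sat w rho' [:: v; u; k] dist_fml.
  move=> v u k rho rho' vN uN kN H3 H4.
  apply/idP/idP; apply: H => // *; first [exact: H3|exact: H4|exact/esym/H3|exact/esym/H4].
move=> vN uN kN H3 H4 /(dist_satP _ vN uN kN)[uv H]; apply/dist_satP => //; split=> //.
case: H => [[e ->]|[x [k1 [k2 [[vx qx k1N k2N [D1 D2]] e]]]]]; [left|right].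
  by rewrite -H3.
by exists x, k1, k2; rewrite -!H4 ?(letter_size qx).
Qed.

Lemma parity_guarded : guarded 5 w 5 parity_fml.
Proof.
suff H v u k (rho rho' : rels) : v < N -> u < N -> k < N ->
    (forall a b, a < N -> b < N -> rho 3 a b b = rho' 3 a b b) ->
    (forall a b c, v < a -> a < N -> b < N -> c < N -> rho 5 a b c = rho' 5 a b c) ->
    sat w rho [:: v; u; k] parity_fml -> sat w rho' [:: v; u; k] parity_fml.
  move=> v u k rho rho' vN uN kN H3 H5.
  apply/idP/idP; apply: H => // *; first [exact: H3|exact: H5|exact/esym/H3|exact/esym/H5].
move=> vN uN kN H3 H5 /(parity_satP _ vN uN kN)[uv H]; apply/parity_satP => //; split=> //.
case: H => [[e b0]|[x [k1 [k2 [[vx qx k1N k2N [D1 D2]] e]]]]]; [left|right].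
  by rewrite -H3.
by exists x, k1, k2; rewrite -!H5 ?(letter_size qx).
Qed.

Lemma syntax_error_spec (rho : rels) :
  (forall i v z, i < N -> v < N -> z < N ->
    rho 0 i v z = (lead (drop i.+1 w) == nat_bits v)) ->
  (forall i v z, i < N -> v < N -> z < N ->
    rho 1 i v z = second_lead (drop i.+1 w) v) ->
  (forall i v z, i < N -> v < N -> z < N ->
    rho 2 i v z = starts_atom (rest (drop i.+1 w))) ->
  ~~ sat w rho [::] syntax_error_fml <-> syntax_ok w.
Proof.
move=> num snd sta.
have errE : sat w rho [::] syntax_error_fml = has (fun i =>
  [|| (i == 0) && ~~ letter w is_quant i,
      [&& letter w is_quant i, i.+1 < N & ~~ letter w (fun a => is_quant a || is_E a) i.+1],
      letter w is_E i && ~~ has (fun u => has (fun v =>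
         (rho 0 i u u && rho 1 i v v) && (letter w is_quant u && letter w is_quant v))
         (iota 0 N)) (iota 0 N)
    | letter w is_comma i && ~~ rho 2 i i i]) (iota 0 N).
  rewrite /=; apply: eq_has => i /=.
  by rewrite (has_next N i (fun j => ~~ letter w _ j)) !negb_and !negbK !addn0 !negb_or !negbK.
rewrite errE; split=> [/hasPn H|[hd Hw]].
  split.
    case: w H {errE num snd sta} => [//|a s] /(_ 0); rewrite mem_iota /= => /(_ isT).
    by rewrite /letter /=; case: (is_quant a).
  move=> i a ia; have iN : i < N by rewrite -onthTE ia.
  have := H i; rewrite mem_iota => /(_ iN); rewrite !negb_or => /and4P[_ Hq HE Hc].
  have la f : letter w f i = f a by rewrite /letter ia.
  case: a ia la => [ia la|ia la|ia la|ia la|b _ _] //=.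
  - move: Hq; rewrite drop_next la /letter -onthTE.
    by case: (onth w i.+1) => [[]|].
  - move: Hq; rewrite drop_next la /letter -onthTE.
    by case: (onth w i.+1) => [[]|].
  - move: HE; rewrite la /= negbK => /has_iotaP[u uN /has_iotaP[v vN]].
    by rewrite num // snd // => /andP[/andP[/eqP e1 e2] /andP[qu qv]]; exists u, v.
  - by move: Hc; rewrite la /= negbK sta.
apply/hasPn => i; rewrite mem_iota add0n => /= iN.
have [a ia] : exists a, onth w i = Some a.
  by move: iN; rewrite -onthTE; case: (onth w i) => // a _; exists a.
have la f : letter w f i = f a by rewrite /letter ia.
have := Hw i a ia; rewrite !la !negb_or !negb_and !negbK => Ha.
apply/and4P; split.
- case: (eqVneq i 0) => //= i0; move: ia hd; rewrite i0.
  by case: (w) => //= b s [->].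
- move: Ha; rewrite drop_next /letter -onthTE.
  by case: (onth w i.+1) => [[| | | |?]|]; case: a {ia la}.
- case: a Ha {ia la} => //= -[u [v [qu qv e1 e2]]].
  have [uN vN] := (letter_size qu, letter_size qv).
  apply/has_iotaP; exists u => //; apply/has_iotaP; exists v => //.
  by rewrite num // snd // e1 eqxx e2 qu qv.
- by case: a Ha {ia la} => //=; rewrite sta.
Qed.

Lemma pin_satP (rho : rels) : ~~ sat w rho [::] pin_fml <->
  (forall x u, u < x < N -> letter w is_ex2 x -> ~~ rho 4 x u 0).
Proof.
split.
  move=> H x u /andP[ux xN] x2; apply: contra H => Dx /=.
  apply/has_iotaP; exists x => //; apply/has_iotaP; exists u; first exact: ltn_trans xN.
  apply/has_iotaP; exists 0; first exact: leq_ltn_trans xN.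
  by rewrite has_leq // x2 Dx addn1 ux.
move=> H; apply/negP => /= /has_iotaP[x xN /has_iotaP[u uN /has_iotaP[k kN]]].
rewrite has_leq // addn1 !addn0 => /andP[/andP[x2 ux] /andP[/eqP k0]].
by rewrite k0; apply/negP/H => //; rewrite ux.
Qed.

Lemma odd_satP (rho : rels) : ~~ sat w rho [::] odd_fml <->
  (forall v b, b < N -> letter w is_quant v -> b != 0 -> ~~ rho 5 v v b).
Proof.
split.
  move=> H v b bN qv b0; apply: contra H => Wv /=.
  apply/has_iotaP; exists v; first exact: letter_size qv.
  by apply/has_iotaP; exists b => //; rewrite qv Wv !addn0 b0.
move=> H; apply/negP => /= /has_iotaP[v vN /has_iotaP[b bN]].
by rewrite !addn0 => /and3P[qv b0]; apply/negP/H.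
Qed.

End Word.

Definition definitions : seq (nat * fml token) :=
  [:: (0, num_fml); (1, second_fml); (2, starts_fml); (3, edge_fml);
      (4, dist_fml); (5, parity_fml)].

Lemma well_defined_definitions w : well_defined 5 5 w definitions.
Proof.
split=> //; first exact: num_guarded.
split=> //; first exact: second_guarded.
split=> //; first exact: starts_guarded.
split=> //; first exact: edge_guarded.
split=> //; first exact: dist_guarded.
by split=> //; apply: parity_guarded.
Qed.

(** There are two families of relations because the equation of D is known for the contents right
    after its computation, and that of W for the contents one stage later. *)
Lemma holds_game (phi : sentence) (rho rho' : rels) :
  let N := size (encode phi) in
  (forall u v z, u < N -> v < N -> z < N ->
     rho 3 u v z <-> has_atom (encode phi) u v \/ has_atom (encode phi) v u) ->
  (forall u v z, u < N -> v < N -> z < N ->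
     rho' 3 u v z <-> has_atom (encode phi) u v \/ has_atom (encode phi) v u) ->
  (forall v u k, v < N -> u < N -> k < N ->
     rho 4 v u k <-> dist_rule (encode phi) (fun u v => rho 3 u v v) (rho 4) v u k) ->
  (forall v u b, v < N -> u < N -> b < N ->
     rho' 5 v u b <-> parity_rule (encode phi) (fun u v => rho' 3 u v v) (rho' 5) v u b) ->
  holds Pinf_edge phi <->
  (forall x u, u < x < N -> letter (encode phi) is_ex2 x -> ~~ rho 4 x u 0) /\
  (forall v b, b < N -> letter (encode phi) is_quant v -> b != 0 -> ~~ rho' 5 v v b).
Proof.
move=> N E3 E3' E4 E5; set m := nvars phi.
pose l := map (fun e => (val e.1, val e.2)) (atoms phi).
pose ed u v := ((u, v) \in l) || ((v, u) \in l).
have mN : m <= N by rewrite /N encodeE size_cat size_map size_tuple leq_addr.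
have quantE i : letter (encode phi) is_quant i = (i < m).
  by rewrite letter_encode // is_quant_encode andbT.
have ex2E i : letter (encode phi) is_ex2 i = is_ge2 (nth ExistsGe1 (qprefix phi) i).
  rewrite letter_encode; last by case.
  (* Beyond the prefix the default [ExistsGe1] makes both sides false. *)
  by case: ltnP => im; [case: (nth _ _ _) | rewrite nth_default // size_tuple].
have l_m u v : (u, v) \in l -> u < m /\ v < m.
  by case/mapP=> -[i k] _ [-> ->]; rewrite !ltn_ord.
have ed_m u v : ed u v -> u < m /\ v < m by case/orP => /l_m[].
have ed_N u v : ed u v -> 1 < N.
  have : (exists e, e \in l) -> 1 < N.
    case=> e; rewrite /N encodeE -/l size_cat => el.
    apply: leq_trans (leq_addl _ _); case: (l) el => // e' l' _.
    by rewrite /atoms_code /= !size_cat /= !addnS.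
  by move=> H /orP[]; [move=> ?; apply: H; exists (u, v) | move=> ?; apply: H; exists (v, u)].
have edP u v : has_atom (encode phi) u v \/ has_atom (encode phi) v u <-> ed u v.
  by rewrite encodeE !has_atom_code /ed; split=> /orP.
have edE u v : u < N -> v < N -> rho 3 u v v = ed u v.
  by move=> uN vN; apply/idP/idP => [/(E3 u v v uN vN vN)/edP|/edP/(E3 u v v uN vN vN)].
have edE' u v : u < N -> v < N -> rho' 3 u v v = ed u v.
  by move=> uN vN; apply/idP/idP => [/(E3' u v v uN vN vN)/edP|/edP/(E3' u v v uN vN vN)].
pose P (vs : seq int) := forall i k, (i, k) \in atoms phi ->
  exists a b, [/\ onth vs (val i) = Some a, onth vs (val k) = Some b & Pinf_edge a b].
have PE vs : size vs = m -> (P vs <-> forall u v, ed u v -> `|nth 0 vs u - nth 0 vs v|%R = 1%R).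
  move=> sv; have onthE (i : 'I_m) : onth vs i = Some (nth 0%R vs i).
    by rewrite seq.onthE (nth_map 0%R) ?sv.
  split=> [HP u v|H i k ik].
    case/orP=> /mapP[[i k] ik [-> ->]]; have [a [b []]] := HP i k ik;
      rewrite !onthE => -[<-] [<-] //.
    by rewrite distrC.
  exists (nth 0%R vs i), (nth 0%R vs k); rewrite !onthE; split=> //; apply: H.
  by apply/orP; left; apply/mapP; exists (i, k).
have := @game m N (qprefix phi) ed (rho 4) (rho' 5) P mN (size_tuple _).
have edC : symmetric ed by move=> u v; rewrite /ed orbC.
case/(_ edC ed_m ed_N PE).
- move=> v u k vN uN kN; rewrite E4 // /dist_rule edE //.
  split=> -[uv [H|[x [k1 [k2 [H e]]]]]]; split=> //; [by left|right|by left|right];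
    exists x, k1, k2; move: H e; rewrite ex2E quantE.
    by case=> vx xm k1N k2N [D1 D2]; rewrite vx xm.
  by case=> /andP[vx xm] k1N k2N D1 D2.
- move=> v u k vN uN kN; rewrite E5 // /parity_rule edE' //.
  split=> -[uv [H|[x [k1 [k2 [H e]]]]]]; split=> //; [by left|right|by left|right];
    exists x, k1, k2; move: H e; rewrite quantE.
    by case=> vx xm k1N k2N [D1 D2]; rewrite vx xm.
  by case=> /andP[vx xm] k1N k2N D1 D2.
rewrite /Win /= drop0 => H1 H2; split.
  case/H1=> Hp Ho; split=> [x u /andP[ux xN]|v b bN]; last by rewrite quantE; move=> ? ?; apply: Ho.
  rewrite ex2E => x2; apply: Hp => //; rewrite ux.
  by case: ltnP x2 => // mx; rewrite nth_default // size_tuple.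
case=> Hp Ho; apply: H2; split=> [x u /andP[ux xm]|v b vm bN b0].
  by rewrite -ex2E => x2; apply: Hp => //; rewrite ux (leq_trans xm mN).
by apply: Ho => //; rewrite quantE.
Qed.

Theorem theorem14 : polytime_decidable encode (holds Pinf_edge).
Proof.
(* Variable levels up to 5 occur, in [dist_fml] and [parity_fml], and the relations are numbered 0
   to 5. *)
apply: (@program_polytime _ 5 5 definitions final_fml) => //.
  exact: well_defined_definitions.
(* Each family holds the contents after one more definition: [eq1] to [eq5] are the new equations,
   and [ag1] to [ag5] carry earlier facts forward, as only the relation just defined has changed. *)
move=> w rho rho0 _ eq0 rho1 ag1 eq1 rho2 ag2 eq2 rho3 ag3 eq3 rho4 ag4 eq4 rho5 ag5 eq5.
set N := size w in ag1 ag2 ag3 ag4 ag5 eq0 eq1 eq2 eq3 eq4 eq5.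
have num0 := num_spec eq0.
have num1 i v z : i < N -> v < N -> z < N ->
    rho1 0 i v z = (lead (drop i.+1 w) == nat_bits v).
  by move=> iN vN zN; rewrite ag1 // num0.
have snd1 := second_spec num1 eq1.
have sta2 := starts_spec eq2.
have num3 i v z : i < N -> v < N -> z < N ->
    rho3 0 i v z = (lead (drop i.+1 w) == nat_bits v).
  by move=> iN vN zN; rewrite ag3 // ag2 // num1.
have snd3 i v z : i < N -> v < N -> z < N ->
    rho3 1 i v z = second_lead (drop i.+1 w) v.
  by move=> iN vN zN; rewrite ag3 // ag2 // snd1.
have edg3 u v z : u < N -> v < N -> z < N ->
    rho3 3 u v z <-> has_atom w u v \/ has_atom w v u.
  by move=> uN vN zN; rewrite eq3 //; apply: edge_spec.
have num5 i v z : i < N -> v < N -> z < N ->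
    rho5 0 i v z = (lead (drop i.+1 w) == nat_bits v).
  by move=> iN vN zN; rewrite ag5 // ag4 // num3.
have snd5 i v z : i < N -> v < N -> z < N ->
    rho5 1 i v z = second_lead (drop i.+1 w) v.
  by move=> iN vN zN; rewrite ag5 // ag4 // snd3.
have sta5 i v z : i < N -> v < N -> z < N ->
    rho5 2 i v z = starts_atom (rest (drop i.+1 w)).
  by move=> iN vN zN; rewrite ag5 // ag4 // ag3 // sta2.
have edg5 u v z : u < N -> v < N -> z < N ->
    rho5 3 u v z <-> has_atom w u v \/ has_atom w v u.
  by move=> uN vN zN; rewrite ag5 // ag4 //; apply: edg3.
have edg4 u v z : u < N -> v < N -> z < N ->
    rho4 3 u v z <-> has_atom w u v \/ has_atom w v u.
  by move=> uN vN zN; rewrite ag4 //; apply: edg3.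
have dist4 v u k : v < N -> u < N -> k < N ->
    rho4 4 v u k <-> dist_rule w (fun u v => rho4 3 u v v) (rho4 4) v u k.
  by move=> vN uN kN; rewrite eq4 //; apply: dist_satP.
have par5 v u b : v < N -> u < N -> b < N ->
    rho5 5 v u b <-> parity_rule w (fun u v => rho5 3 u v v) (rho5 5) v u b.
  by move=> vN uN bN; rewrite eq5 //; apply: parity_satP.
have pin45 x u : u < x < N -> rho5 4 x u 0 = rho4 4 x u 0.
  by move=> /andP[ux xN]; rewrite ag5 ?(ltn_trans ux xN) ?(leq_ltn_trans _ xN).
have synE := syntax_error_spec num5 snd5 sta5.
rewrite /final_fml; split.
  case/and3P=> /synE/syntax_okP[phi ew] /pin_satP Hp /odd_satP Ho.
  exists phi => //; subst w; apply/(holds_game edg4 edg5 dist4 par5); split=> // x u xu x2.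
  by rewrite -pin45 // Hp.
case=> phi ew; subst w => /(holds_game edg4 edg5 dist4 par5)[Hp Ho].
apply/and3P; split; [by apply/synE/syntax_okP; exists phi| |exact/odd_satP].
by apply/pin_satP => x u xu x2; rewrite pin45 // Hp.
Qed.
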